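(* Let $n\ge 2$ be an integer and let $g$ be a non-trivial element of $\operatorname{BS}(1,n)$. Then either $\operatorname{Stab}(g)\cong\mathbb{Z}\left[\tfrac{1}{n}\right]$ (as groups), or $\operatorname{Stab}(g)$ is a finitely generated abelian group whose rank equals the number of distinct primes dividing $n$, and a finite set of generators of it is computable.
   Context: $\operatorname{BS}(1,n)=\langle a,t\mid tat^{-1}=a^n\rangle$. For a group $G$ and $g\in G$, $\operatorname{Stab}(g)=\{\varphi\in\operatorname{Aut}(G)\mid\varphi(g)=g\}$, a subgroup of $\operatorname{Aut}(G)$. $\mathbb{Z}\left[\tfrac1n\right]$ denotes the additive group $\{l/n^k\mid l\in\mathbb{Z},k\ge 0\}\subset\mathbb{Q}$. The rank of a finitely generated abelian group is its torsion-free rank (the group may have torsion). ''Computable'' means that there is an algorithm which, given $n$ and $g$, outputs a finite generating set (each automorphism specified by the images of the two generators of $\operatorname{BS}(1,n)$). *)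

(* Defs.v *)
From HB Require Import structures.
From mathcomp Require Import all_boot all_algebra.
From mathcomp Require Import boolp.

Set Implicit Arguments.
Unset Strict Implicit.
Unset Printing Implicit Defensive.

Import GRing.Theory.

(* A letter (x, b) stands for the generator x if b = false, and for x^-1 if
   b = true. *)
Definition letter (X : Type) : Type := (X * bool)%type.
Definition word (X : Type) : Type := seq (letter X).

Definition inv_letter X (l : letter X) : letter X := (l.1, ~~ l.2).
Definition inv_word X (w : word X) : word X := rev (map (@inv_letter X) w).

Inductive pres_eq (X : Type) (R : word X -> word X -> Prop) :
    word X -> word X -> Prop :=
| pres_rel r s : R r s -> pres_eq R r s
| pres_cancel l : pres_eq R [:: l; inv_letter l] [::]
| pres_cat u u' v v' :
    pres_eq R u u' -> pres_eq R v v' -> pres_eq R (u ++ v) (u' ++ v')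
| pres_refl w : pres_eq R w w
| pres_sym u v : pres_eq R u v -> pres_eq R v u
| pres_trans u v w : pres_eq R u v -> pres_eq R v w -> pres_eq R u w.

Section Presented.
Variables (X : choiceType) (R : word X -> word X -> Prop).

Definition pres_eqb : rel (word X) := fun u v => `[< pres_eq R u v >].

Fact pres_eqb_refl : reflexive pres_eqb.
Proof. by move=> w; apply/asboolP/pres_refl. Qed.

Fact pres_eqb_sym : symmetric pres_eqb.
Proof. by move=> u v; apply/asboolP/asboolP; apply: pres_sym. Qed.

Fact pres_eqb_trans : transitive pres_eqb.
Proof. by move=> v u w /asboolP uv /asboolP vw; apply/asboolP/(pres_trans uv). Qed.

Canonical pres_equiv :=
  EquivRel pres_eqb pres_eqb_refl pres_eqb_sym pres_eqb_trans.

Definition presented := {eq_quot pres_equiv}%qT.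
HB.instance Definition _ := Choice.on presented.

Definition word_class (w : word X) : presented := (\pi_(presented) w)%qT.

Lemma word_classP u v : word_class u = word_class v <-> pres_eq R u v.
Proof. by split=> [/eqmodP/asboolP | uv]; last exact/eqmodP/asboolP. Qed.

Lemma word_class_surj (x : presented) : exists w, word_class w = x.
Proof. by exists (repr x); rewrite /word_class reprK. Qed.

Lemma inv_wordK : involutive (@inv_word X).
Proof.
move=> w; rewrite /inv_word map_rev revK -map_comp map_id_in // => -[x b] _.
by rewrite /inv_letter /= negbK.
Qed.

Lemma pres_eq_invr w : pres_eq R (w ++ inv_word w) [::].
Proof.
elim: w => [|l w IHw]; first exact: pres_refl.
apply: pres_trans (pres_cancel R l).
have -> : (l :: w) ++ inv_word (l :: w) =
          [:: l] ++ (w ++ inv_word w) ++ [:: inv_letter l].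
  by rewrite /inv_word map_cons rev_cons -cats1 /= !catA.
have -> : [:: l; inv_letter l] = [:: l] ++ [::] ++ [:: inv_letter l] by [].
by apply: pres_cat (pres_refl _ _) _; apply: pres_cat IHw (pres_refl _ _).
Qed.

Lemma pres_eq_invl w : pres_eq R (inv_word w ++ w) [::].
Proof. by rewrite -{2}[w]inv_wordK; apply: pres_eq_invr. Qed.

Lemma pres_eq_inv u v : pres_eq R u v -> pres_eq R (inv_word u) (inv_word v).
Proof.
move=> uv; apply: (@pres_trans _ _ _ (inv_word u ++ (v ++ inv_word v))).
  rewrite -[X in pres_eq _ X]cats0.
  by apply: pres_cat (pres_refl _ _) _; apply/pres_sym/pres_eq_invr.
rewrite catA -[X in pres_eq _ _ X]cat0s.
apply: pres_cat (pres_refl _ _).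
apply: pres_trans (pres_eq_invl u).
by apply: pres_cat (pres_refl _ _) _; apply/pres_sym.
Qed.

Definition pres_one : presented := word_class [::].
Definition pres_mul (x y : presented) : presented :=
  word_class (repr x ++ repr y).
Definition pres_inv (x : presented) : presented :=
  word_class (inv_word (repr x)).

Lemma pres_mulE u v :
  pres_mul (word_class u) (word_class v) = word_class (u ++ v).
Proof.
by apply/word_classP/pres_cat; apply/word_classP; rewrite /word_class reprK.
Qed.

Lemma pres_invE u : pres_inv (word_class u) = word_class (inv_word u).
Proof.
by apply/word_classP/pres_eq_inv; apply/word_classP; rewrite /word_class reprK.
Qed.

Fact pres_mulA : associative pres_mul.
Proof.
move=> x y z; have [u <-] := word_class_surj x; have [v <-] := word_class_surj y.
by have [w <-] := word_class_surj z; rewrite !pres_mulE catA.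
Qed.

Fact pres_mul1 : left_id pres_one pres_mul.
Proof. by move=> x; have [u <-] := word_class_surj x; rewrite pres_mulE. Qed.

Fact pres_mulr1 : right_id pres_one pres_mul.
Proof.
by move=> x; have [u <-] := word_class_surj x; rewrite pres_mulE cats0.
Qed.

Fact pres_mulrV : right_inverse pres_one pres_inv pres_mul.
Proof.
move=> x; have [w <-] := word_class_surj x; rewrite pres_invE pres_mulE.
exact/word_classP/pres_eq_invr.
Qed.

Fact pres_mulV : left_inverse pres_one pres_inv pres_mul.
Proof.
move=> x; have [w <-] := word_class_surj x; rewrite pres_invE pres_mulE.
exact/word_classP/pres_eq_invl.
Qed.

HB.instance Definition _ := isGroup.Build presented
  pres_mulA pres_mul1 pres_mulr1 pres_mulV pres_mulrV.

End Presented.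

Inductive bs_gen := GenA | GenT.

Definition bool_of_gen (x : bs_gen) : bool := if x is GenA then false else true.
Definition gen_of_bool (b : bool) : bs_gen := if b then GenT else GenA.
Fact bool_of_genK : cancel bool_of_gen gen_of_bool. Proof. by case. Qed.
HB.instance Definition _ := Countable.copy bs_gen (can_type bool_of_genK).

Notation bs_word := (word bs_gen).

Inductive BS_rel (n : nat) : bs_word -> bs_word -> Prop :=
| BSRel : BS_rel n [:: (GenT, false); (GenA, false); (GenT, true)]
                   (nseq n (GenA, false)).

Definition BS (n : nat) : groupType := presented (BS_rel n).
Definition bs_class (n : nat) (w : bs_word) : BS n := word_class (BS_rel n) w.
Definition bs_a (n : nat) : BS n := bs_class n [:: (GenA, false)].
Definition bs_t (n : nat) : BS n := bs_class n [:: (GenT, false)].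

Section Automorphisms.
Local Open Scope group_scope.
Variable G : groupType.

Definition is_aut : pred (G -> G) :=
  fun f => `[< {morph f : x y / x * y} /\ bijective f >].

Record Aut := MkAut { aut_fun :> G -> G; _ : is_aut aut_fun }.
HB.instance Definition _ := [isSub for aut_fun].
HB.instance Definition _ := [Choice of Aut by <:].

Lemma autM (f : Aut) : {morph f : x y / x * y}.
Proof. by case: f => f /= /asboolP[]. Qed.

Lemma aut_bij (f : Aut) : bijective f.
Proof. by case: f => f /= /asboolP[]. Qed.

Lemma autP (f h : Aut) : f =1 h -> f = h.
Proof. by move=> fh; apply/val_inj/funext. Qed.

Fact is_aut_id : is_aut id.
Proof. by apply/asboolP; split=> //; exists id. Qed.
Definition aut_one := MkAut is_aut_id.

Fact is_aut_comp (f h : Aut) : is_aut (f \o h).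
Proof.
apply/asboolP; split; last by apply: bij_comp; apply: aut_bij.
by move=> x y /=; rewrite !autM.
Qed.
Definition aut_mul (f h : Aut) := MkAut (is_aut_comp f h).

Fact aut_inv_subproof (f : Aut) : {h : Aut | cancel f h /\ cancel h f}.
Proof.
apply: cid; have [h fK hK] := aut_bij f.
have aut_h : is_aut h.
  apply/asboolP; split; last by exists f.
  by move=> x y; apply: (can_inj fK); rewrite autM !hK.
by exists (MkAut aut_h).
Qed.
Definition aut_inv (f : Aut) : Aut := sval (aut_inv_subproof f).

Lemma aut_invK (f : Aut) : cancel f (aut_inv f).
Proof. by have [] := svalP (aut_inv_subproof f). Qed.

Lemma aut_invVK (f : Aut) : cancel (aut_inv f) f.
Proof. by have [] := svalP (aut_inv_subproof f). Qed.

Fact aut_mulA : associative aut_mul. Proof. by move=> f h k; apply: autP. Qed.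
Fact aut_mul1 : left_id aut_one aut_mul. Proof. by move=> f; apply: autP. Qed.
Fact aut_mulr1 : right_id aut_one aut_mul. Proof. by move=> f; apply: autP. Qed.
Fact aut_mulV : left_inverse aut_one aut_inv aut_mul.
Proof. by move=> f; apply: autP => x; apply: aut_invK. Qed.
Fact aut_mulrV : right_inverse aut_one aut_inv aut_mul.
Proof. by move=> f; apply: autP => x; apply: aut_invVK. Qed.

HB.instance Definition _ :=
  isGroup.Build Aut aut_mulA aut_mul1 aut_mulr1 aut_mulV aut_mulrV.

Section Stabilizer.
Variable g : G.

Definition stab : {pred Aut} := fun f => f g == g.

Fact stab_closed : group_closed stab.
Proof.
split=> [|f h /eqP fg /eqP hg]; first exact/eqP.
apply/eqP; rewrite -[RHS]fg; congr (aut_fun f _).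
by rewrite -[in LHS]hg; apply: aut_invK.
Qed.

Record Stab := MkStab { stab_aut :> Aut; _ : stab_aut \in stab }.
HB.instance Definition _ := [isSub for stab_aut].
HB.instance Definition _ := [Choice of Stab by <:].
HB.instance Definition _ := SubChoice_isSubGroup.Build Aut stab Stab stab_closed.

End Stabilizer.
End Automorphisms.

Section Zinv.
Local Open Scope ring_scope.
Variable n : nat.

Definition in_Zinv : {pred rat} :=
  fun q => `[< exists (l : int) (k : nat), q = l%:~R / n%:R ^+ k >].

Fact in_Zinv_closed : zmod_closed in_Zinv.
Proof.
split; first by apply/asboolP; exists 0, 0%N; rewrite mul0r.
move=> _ _ /asboolP[l [k ->]] /asboolP[l' [k' ->]]; apply/asboolP.
have [->|n0] := eqVneq n 0%N.
  case: k => [|k]; case: k' => [|k'].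
  - by exists (l - l'), 0%N; rewrite expr0 !divr1 rmorphB.
  - by exists l, 0%N; rewrite !expr0 exprS mul0r invr0 mulr0 subr0.
  - by exists (- l'), 0%N; rewrite !expr0 exprS mul0r invr0 mulr0 sub0r rmorphN mulNr.
  - by exists 0, 0%N; rewrite !exprS !mul0r invr0 !mulr0 subr0.
exists (l * n%:Z ^+ k' - l' * n%:Z ^+ k), (k + k')%N.
have nQ0 i : (n%:R : rat) ^+ i != 0 by rewrite expf_neq0 ?Num.Theory.pnatr_eq0.
rewrite rmorphB !rmorphM !rmorphXn /= -pmulrn exprD mulrBl; congr (_ - _).
  by rewrite -mulf_div divff // mulr1.
by rewrite [n%:R ^+ k * _]mulrC -mulf_div divff // mulr1.
Qed.

Record Zinv := MkZinv { Zinv_val :> rat; _ : Zinv_val \in in_Zinv }.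
HB.instance Definition _ := [isSub for Zinv_val].
HB.instance Definition _ := [Choice of Zinv by <:].
HB.instance Definition _ :=
  GRing.SubChoice_isSubZmodule.Build rat in_Zinv Zinv in_Zinv_closed.

End Zinv.

Section GroupNotions.
Local Open Scope group_scope.

Definition isomorphic_additive (G : groupType) (A : zmodType) : Prop :=
  exists2 f : G -> A, {morph f : x y / x * y >-> (x + y)%R} & bijective f.

Definition abelian_group (G : groupType) : Prop := forall x y : G, x * y = y * x.

Definition generates (G : groupType) (s : seq G) : Prop :=
  forall H : {pred G}, group_closed H -> {subset s <= H} -> forall x, x \in H.

Definition finitely_generated (G : groupType) : Prop :=
  exists s : seq G, generates s.

Definition expgz (G : groupType) (x : G) (m : int) : G :=
  match m with Posz k => x ^+ k | Negz k => x ^- k.+1 end.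

Definition Zindependent (G : groupType) (r : nat) (x : 'I_r -> G) : Prop :=
  forall m : 'I_r -> int, \prod_(i < r) expgz (x i) (m i) = 1 ->
    forall i, m i = 0%R.

(* The torsion-free rank; meaningful for abelian G. *)
Definition has_rank (G : groupType) (r : nat) : Prop :=
  (exists x : 'I_r -> G, Zindependent x) /\
  (forall (s : nat) (x : 'I_s -> G), Zindependent x -> s <= r).

End GroupNotions.

(* Programs for the partial recursive functions of several natural numbers.
   Arities are not enforced: an argument beyond the end of the argument list
   reads as 0. *)
Inductive recfun : Type :=
| RZero
| RSucc
| RProj of nat
| RComp of recfun & seq recfun
| RPrim of recfun & recfun
| RMin of recfun.

(* [computes p v y]: the program p halts on the arguments v with value y. *)
Fixpoint computes (p : recfun) (v : seq nat) (y : nat) {struct p} : Prop :=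
  match p with
  | RZero => y = 0
  | RSucc => y = (nth 0 v 0).+1
  | RProj i => y = nth 0 v i
  | RComp f gs =>
      exists2 ws : seq nat,
        (fix computes_all (gs : seq recfun) (ws : seq nat) {struct gs} : Prop :=
           match gs, ws with
           | [::], [::] => True
           | h :: gs', w :: ws' => computes h v w /\ computes_all gs' ws'
           | _, _ => False
           end) gs ws
        & computes f ws y
  | RPrim f h =>
      (fix iterate (k : nat) (z : nat) {struct k} : Prop :=
         match k with
         | 0 => computes f (behead v) z
         | k'.+1 =>
             exists2 u, iterate k' u & computes h [:: k', u & behead v] z
         end) (nth 0 v 0) y
  | RMin f =>
      computes f (y :: v) 0 /\
      (forall z, z < y -> exists u, computes f (z :: v) u.+1)
  end.

Definition code_letter (l : letter bs_gen) : nat :=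
  match l with
  | (GenA, false) => 0
  | (GenA, true) => 1
  | (GenT, false) => 2
  | (GenT, true) => 3
  end.

Definition code_word (w : bs_word) : nat := CodeSeq.code (map code_letter w).

Definition code_pair (p : bs_word * bs_word) : nat :=
  CodeSeq.code [:: code_word p.1; code_word p.2].

Definition code_pairs (ps : seq (bs_word * bs_word)) : nat :=
  CodeSeq.code (map code_pair ps).

Definition specifies (n : nat) (g : BS n)
    (ps : seq (bs_word * bs_word)) (s : seq (Stab g)) : Prop :=
  [seq (bs_class n p.1, bs_class n p.2) | p <- ps] =
  [seq (f (bs_a n), f (bs_t n)) | f : Stab g <- s].

Definition outputs_generators (p : recfun) (n : nat) (g : BS n) : Prop :=
  forall w : bs_word, bs_class n w = g ->
    exists ps : seq (bs_word * bs_word),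
      computes p [:: n; code_word w] (code_pairs ps) /\
      exists2 s : seq (Stab g), specifies ps s & generates s.

(* Main.v *)
(* BS(1,n) is Z[1/n] x| Z, acting faithfully on Q by y |-> x + n^k y, with
   a = (1, 0) and t = (0, 1).  Every automorphism sends a to (u, 0) and t to
   (v, 1) with u a unit of Z[1/n], hence (x, k) to (u x + v [k], k), where
   [k] = (n^k - 1)/(n - 1).  For k = 0 and x <> 0 the stabilizer of (x, k) is
   given by u = 1 and v arbitrary, so it is Z[1/n].  For k <> 0 it is the group
   of units u such that v = (1 - u) x/[k] lies in Z[1/n]; up to a power of n,
   x/[k] is y/N with y an integer and N = 1 + n + ... + n^(|k|-1) prime to n, so
   the condition reads N | (1 - u) y.  With M = N!, a multiple of the order of
   every unit mod N, all p^M with p | n prime qualify.  Dividing them out shows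
   that the group is generated by the admissible integers u with |u| dividing
   n^M, a finite set found by trial division, and p-adic valuations give the
   rank. *)
Require Import Defs.
From HB Require Import structures.
From mathcomp Require Import all_boot all_algebra.
From mathcomp Require Import boolp.
From mathcomp Require cyclic.
From mathcomp Require Import zify ring.

Set Implicit Arguments.
Unset Strict Implicit.
Unset Printing Implicit Defensive.

Import GRing.Theory Num.Theory.

(** * The affine model of BS(1,n) *)

(** The defining relation alone forces the shape of an automorphism: comparing heights in t a t^-1 =
    a^n shows that the image of a has height 0, and comparing translations then shows that the image
    of t has height 1. Computability is the obstacle that shapes the second half. Programs know only
    natural numbers and must accept any word for g. So integers are kept as differences of naturals,
    and the code c of the word does triple duty: it bounds the length of the word, hence the loops;
    it shifts heights so that they stay nonnegative; and n^c is a common denominator for the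
    translation. M = N! is chosen in the same spirit: one exponent, easy to program, serves all
    primes dividing n at once. The sign u = -1 may be admissible, so the group can have torsion, and
    relations found through valuations hold only up to sign. *)

Section Affine.
Local Open Scope ring_scope.
Variable n : nat.

(* The pair (x, k) stands for the affine map y |-> x + n^k y. *)
Definition aff_mul (p q : rat * int) : rat * int :=
  (p.1 + n%:R ^ p.2 * q.1, p.2 + q.2).

Definition aff_letter (l : letter bs_gen) : rat * int :=
  match l.1 with
  | GenA => ((-1) ^+ l.2, 0)
  | GenT => (0, (-1) ^+ l.2)
  end.

Definition aff_word (w : bs_word) : rat * int :=
  foldr aff_mul (0, 0) (map aff_letter w).

Hypothesis n_gt1 : (1 < n)%N.

Fact natQ_neq0 : (n%:R : rat) != 0. Proof. by rewrite pnatr_eq0; lia. Qed.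
Local Hint Resolve natQ_neq0 : core.

Fact natQ_neq1 : (n%:R : rat) != 1.
Proof. by rewrite pnatr_eq1; lia. Qed.

Lemma aff_mul1 p : aff_mul (0, 0) p = p.
Proof. by case: p => x k; rewrite /aff_mul /= expr0z mul1r !add0r. Qed.

Lemma aff_mulA p q r : aff_mul p (aff_mul q r) = aff_mul (aff_mul p q) r.
Proof.
rewrite /aff_mul /= expfzDr //; congr pair; last by rewrite addrA.
by rewrite mulrDr mulrA addrA.
Qed.

Lemma aff_word_cat u v : aff_word (u ++ v) = aff_mul (aff_word u) (aff_word v).
Proof.
elim: u => [|l u IHu]; first by rewrite aff_mul1.
by rewrite /aff_word /= -[foldr _ _ _]/(aff_word _) IHu aff_mulA.
Qed.

Lemma aff_word_nseqA k b :
  aff_word (nseq k (GenA, b)) = ((-1) ^+ b * k%:R, 0).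
Proof.
elim: k => [|k IHk]; first by rewrite mulr0.
rewrite /aff_word /= -[foldr _ _ _]/(aff_word _) IHk /aff_mul /= expr0z mul1r.
by rewrite -[in RHS]natr1 mulrDr mulr1 addrC addr0.
Qed.

Lemma aff_word_nseqT k b :
  aff_word (nseq k (GenT, b)) = (0, (-1) ^+ b * k%:R).
Proof.
elim: k => [|k IHk]; first by rewrite mulr0.
rewrite /aff_word /= -[foldr _ _ _]/(aff_word _) IHk /aff_mul /= mulr0 addr0.
by rewrite -[in RHS]natr1 mulrDr mulr1 addrC.
Qed.

Lemma aff_word_pres u v : pres_eq (BS_rel n) u v -> aff_word u = aff_word v.
Proof.
elim=> {u v} [r s []|l|u u' v v' _ IHu _ IHv|w|u v _ -> //|u v w _ -> _ -> //] //.
- rewrite aff_word_nseqA mul1r /aff_word /= /aff_mul /=.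
  by rewrite !mulr0 !addr0 expr1z mulr1 add0r.
- case: l => [[] []]; rewrite /aff_word /inv_letter /aff_mul /=;
    by rewrite ?expr0z ?mulr0 ?addr0 ?mul1r ?expr0 ?expr1 ?addNr ?subrr.
- by rewrite !aff_word_cat IHu IHv.
Qed.

(** The representative is picked by choice; [aff_word_pres] makes the value independent of it. *)
Definition aff_val (g : BS n) : rat * int :=
  aff_word (sval (cid (word_class_surj g))).

Lemma aff_val_class w : aff_val (bs_class n w) = aff_word w.
Proof.
apply: aff_word_pres; apply/(word_classP (BS_rel n)).
exact: (svalP (cid (word_class_surj (bs_class n w)))).
Qed.

Definition trans (g : BS n) : rat := (aff_val g).1.
Definition height (g : BS n) : int := (aff_val g).2.

Lemma bs_classM u v : bs_class n (u ++ v) = (bs_class n u * bs_class n v)%g.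
Proof. by rewrite /bs_class -[RHS]/(pres_mul _ _) pres_mulE. Qed.

Lemma bs_class_nseq k l :
  bs_class n (nseq k l) = (bs_class n [:: l] ^+ k)%g.
Proof.
elim: k => [|k IHk] //=; rewrite -cat1s bs_classM IHk.
by rewrite expgS.
Qed.

Lemma bs_classV x :
  bs_class n [:: (x, true)] = ((bs_class n [:: (x, false)])^-1)%g.
Proof. by rewrite /bs_class -[RHS]/(pres_inv _) pres_invE. Qed.

Lemma transM g h : trans (g * h)%g = trans g + n%:R ^ height g * trans h.
Proof.
rewrite /trans /height.
have [u <-] := word_class_surj g; have [v <-] := word_class_surj h.
by rewrite -bs_classM !aff_val_class aff_word_cat.
Qed.

Lemma heightM g h : height (g * h)%g = height g + height h.
Proof.
rewrite /height.
have [u <-] := word_class_surj g; have [v <-] := word_class_surj h.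
by rewrite -bs_classM !aff_val_class aff_word_cat.
Qed.

Lemma trans1 : trans 1%g = 0.
Proof. by rewrite /trans aff_val_class. Qed.
Lemma height1 : height 1%g = 0.
Proof. by rewrite /height aff_val_class. Qed.
Lemma trans_a : trans (bs_a n) = 1.
Proof. by rewrite /trans aff_val_class /= mulr0 addr0. Qed.
Lemma height_a : height (bs_a n) = 0.
Proof. by rewrite /height aff_val_class. Qed.
Lemma trans_t : trans (bs_t n) = 0.
Proof. by rewrite /trans aff_val_class /= mulr0 addr0. Qed.
Lemma height_t : height (bs_t n) = 1.
Proof. by rewrite /height aff_val_class /= addr0. Qed.

Lemma heightV g : height g^-1%g = - height g.
Proof. by apply/eqP; rewrite -subr_eq0 opprK -heightM mulVg height1. Qed.

Lemma transV g : trans g^-1%g = - (n%:R ^ (- height g) * trans g).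
Proof.
apply/eqP; rewrite -subr_eq0 opprK addrC addrC -heightV -transM.
by rewrite mulVg trans1.
Qed.

Lemma bs_generates : generates [:: bs_a n; bs_t n].
Proof.
move=> H Hgrp Hat x; have [w <-] := word_class_surj x.
have [H1 _] := Hgrp.
have Hg y : bs_class n [:: (y, false)] \in H.
  by apply: Hat; case: y; rewrite !inE eqxx ?orbT.
elim: w => [|[y b] w IHw] //.
rewrite -cat1s -[word_class _ _]/(bs_class n _) bs_classM.
apply: (group_closedM Hgrp) => //.
by case: b => //; rewrite bs_classV; apply: (group_closedV Hgrp).
Qed.

(** * Normal forms and faithfulness of the affine model *)

Lemma bs_relation : (bs_t n * bs_a n * (bs_t n)^-1 = bs_a n ^+ n)%g.
Proof.
rewrite /bs_t -bs_classV /bs_a -bs_class_nseq -!bs_classM.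
exact/word_classP/pres_rel.
Qed.

Lemma bs_t_aX c : (bs_t n * bs_a n ^+ c = bs_a n ^+ (n * c) * bs_t n)%g.
Proof.
elim: c => [|c IHc]; first by rewrite muln0 !expg0 mul1g mulg1.
rewrite expgSr mulgA IHc -mulgA mulnS addnC expgnDr -mulgA; congr (_ * _)%g.
by rewrite -bs_relation mulgVK.
Qed.

Lemma bs_tX_aX j c :
  (bs_t n ^+ j * bs_a n ^+ c = bs_a n ^+ (n ^ j * c) * bs_t n ^+ j)%g.
Proof.
elim: j c => [|j IHj] c; first by rewrite mul1n !expg0 mul1g mulg1.
by rewrite expgSr -!mulgA bs_t_aX mulgA IHj -mulgA -expgSr mulnA -expnSr.
Qed.

(** Keeping [c] and [d] apart lets t^-i a^(c-d) t^j be written with natural exponents only; the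
    algorithm outputs words of this shape. *)
Definition nf_word (i c d j : nat) : bs_word :=
  nseq i (GenT, true) ++ nseq c (GenA, false) ++ nseq d (GenA, true)
    ++ nseq j (GenT, false).

Lemma bs_class_nf i c d j :
  bs_class n (nf_word i c d j) =
  (bs_t n ^- i * (bs_a n ^+ c * bs_a n ^- d * bs_t n ^+ j))%g.
Proof.
rewrite !bs_classM !bs_class_nseq !bs_classV !expVgn.
by rewrite -!mulgA.
Qed.

Lemma aff_word_nf i c d j :
  aff_word (nf_word i c d j) = ((c%:R - d%:R) / n%:R ^+ i, j%:Z - i%:Z).
Proof.
rewrite !aff_word_cat !aff_word_nseqA !aff_word_nseqT /aff_mul /=.
rewrite !expr0 !expr1 !mul1r addr0 !add0r.
rewrite !natz !mulN1r; congr pair; last by rewrite addrC.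
by rewrite -exprnN mulrC.
Qed.

Lemma bs_normal_form g : exists i c d j, g = bs_class n (nf_word i c d j).
Proof.
pose A := bs_a n; pose T := bs_t n.
have aV d c : commute (A ^- d)%g (A ^+ c)%g.
  by apply/commute_sym/commuteV/commuteX/commute_sym/commuteX.
have [w <-] := word_class_surj g; elim/last_ind: w => [|w l [i [c [d [j def_w]]]]].
  by exists 0%N, 0%N, 0%N, 0%N; rewrite bs_class_nf !expg0 !gsimp.
rewrite -cats1 -[word_class _ _]/(bs_class n _) bs_classM.
rewrite [bs_class n w]def_w bs_class_nf -/A -/T.
case: l => [[] []].
- exists i, c, (d + n ^ j)%N, j; rewrite bs_class_nf -/A -/T bs_classV -/A.
  rewrite -!mulgA; congr (_ * (_ * _))%g.
  apply: (@mulIg _ A); rewrite -!mulgA mulVg mulg1.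
  rewrite -{3}[A]expg1 bs_tX_aX muln1 -/A -/T.
  by rewrite addnC expgnDr invgM -!mulgA mulKg.
- exists i, (c + n ^ j)%N, d, j; rewrite bs_class_nf -/A -/T.
  have -> : bs_class n [:: (GenA, false)] = (A ^+ 1)%g by [].
  rewrite -!mulgA bs_tX_aX muln1 expgnDr -/A -/T; congr (_ * _)%g.
  by rewrite -!mulgA; congr (_ * _)%g; rewrite !mulgA aV.
- case: j {def_w} => [|j].
    (* With no final t left to cancel: t^-i a^m t^-1 = t^-(i+1) a^(n m). *)
    exists i.+1, (n * c)%N, (n * d)%N, 0%N; rewrite bs_class_nf bs_classV -/A -/T.
    rewrite expg0 !mulg1 expgS invgM -!mulgA; congr (_ * _)%g.
    apply: (@mulgI _ T); apply: (@mulIg _ T); rewrite mulVKg -!mulgA mulVg mulg1.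
    rewrite !mulgA bs_t_aX -/T -/A -!mulgA; congr (_ * _)%g.
    apply: (@mulIg _ (A ^+ d)%g); rewrite mulgVK -!mulgA bs_t_aX.
    by rewrite -/T -/A mulKg.
  exists i, c, d, j; rewrite bs_class_nf bs_classV -/A -/T.
  by rewrite expgSr -!mulgA mulgV mulg1.
- exists i, c, d, j.+1; rewrite bs_class_nf -/A -/T.
  by rewrite expgSr -!mulgA.
Qed.

(** A normal form of value (0, 0) has c = d and i = j, hence collapses to 1. *)
Lemma aff_val_inj : injective aff_val.
Proof.
suff ker g : aff_val g = (0, 0) -> g = 1%g.
  move=> g h gh; apply: divg1_eq; apply: ker.
  have eT : trans g = trans h by rewrite /trans gh.
  have eH : height g = height h by rewrite /height gh.
  rewrite [LHS]surjective_pairing -[X in (X, _)]/(trans _) -[X in (_, X)]/(height _).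
  rewrite heightM heightV transM transV eT eH subrr mulrN mulrA -expfzDr //.
  by rewrite subrr expr0z mul1r subrr.
have [i [c [d [j ->]]]] := bs_normal_form g.
rewrite aff_val_class aff_word_nf bs_class_nf => -[/eqP].
rewrite mulf_eq0 invr_eq0 expf_eq0 (negPf natQ_neq0) andbF orbF subr_eq0 eqr_nat.
move=> /eqP -> /eqP; rewrite subr_eq0 eqz_nat => /eqP ->.
by rewrite mulgV mul1g mulVg.
Qed.

Lemma bs_eqP (g h : BS n) : trans g = trans h -> height g = height h -> g = h.
Proof.
move=> eT eH; apply: aff_val_inj.
by rewrite [aff_val g]surjective_pairing [RHS]surjective_pairing -/(trans g) eT -/(height g) eH.
Qed.

Local Notation Zn := (in_Zinv n).

Lemma in_ZinvP (q : rat) :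
  reflect (exists l k, q = (l : int)%:~R / n%:R ^+ k) (q \in Zn).
Proof. exact: asboolP. Qed.

Lemma Zinv_int (l : int) : l%:~R \in Zn.
Proof. by apply/in_ZinvP; exists l, 0%N; rewrite divr1. Qed.

Lemma ZinvM p q : p \in Zn -> q \in Zn -> p * q \in Zn.
Proof.
move=> /in_ZinvP[l [k ->]] /in_ZinvP[l' [k' ->]]; apply/in_ZinvP.
by exists (l * l'), (k + k')%N; rewrite mulf_div exprD intrM.
Qed.

Lemma ZinvB p q : p \in Zn -> q \in Zn -> p - q \in Zn.
Proof. by case: (in_Zinv_closed n) => _; apply. Qed.

Lemma Zinv_expz (k : int) : n%:R ^ k \in Zn.
Proof.
case: k => k; apply/in_ZinvP.
  by exists (n ^ k)%N%:Z, 0%N; rewrite divr1 -pmulrn natrX.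
by exists 1, k.+1; rewrite NegzE -exprnN div1r.
Qed.

Lemma trans_Zinv g : trans g \in Zn.
Proof.
have [i [c [d [j ->]]]] := bs_normal_form g.
rewrite /trans aff_val_class aff_word_nf /=; apply/in_ZinvP.
by exists (c%:Z - d%:Z), i; rewrite rmorphB.
Qed.

Lemma bs_elt x (k : int) : x \in Zn -> {g : BS n | trans g = x & height g = k}.
Proof.
move=> /in_ZinvP xZ; apply: cid2; case: xZ => l [e ->].
(* Enlarging the exponent of the denominator by |k| keeps i + k, the final exponent of t,
   nonnegative. *)
pose i := (e + `|k|)%N; pose m : int := l * n%:Z ^+ `|k|%N.
have [c [d defm]] : exists c d : nat, m = c%:Z - d%:Z.
  case: m => c; first by exists c, 0%N; rewrite subr0.
  by exists 0%N, c.+1; rewrite NegzE sub0r.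
exists (bs_class n (nf_word i c d `|(i%:Z + k)%R|%N));
  rewrite /trans /height aff_val_class aff_word_nf /=.
  have -> : c%:R - d%:R = m%:~R :> rat by rewrite defm rmorphB.
  rewrite /m /i rmorphM rmorphXn /= -pmulrn exprD -mulf_div divff ?mulr1 //.
  by rewrite expf_neq0.
by rewrite /i; lia.
Qed.

End Affine.

(** * Automorphisms and stabilizers *)

Section AutBS.
Local Open Scope ring_scope.
Variable n : nat.
Hypothesis n_gt1 : (1 < n)%N.
Implicit Types (f h : Aut (BS n)) (k l : int).

(** The k-th power of (v, 1) is (v [k], k); [qintD] is the resulting cocycle rule. *)
Definition qint k : rat := (n%:R ^ k - 1) / (n%:R - 1).

Lemma qint0 : qint 0 = 0.
Proof. by rewrite /qint expr0z subrr mul0r. Qed.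

Lemma qint1 : qint 1 = 1.
Proof. by rewrite /qint expr1z divff // subr_eq0 natQ_neq1. Qed.

Lemma qintD k l : qint (k + l) = qint k + n%:R ^ k * qint l.
Proof. rewrite /qint expfzDr ?natQ_neq0 //.
by move: (n%:R ^ k) (n%:R ^ l) (n%:R - 1) => A B c; ring. Qed.

Lemma qint_eq0 k : qint k = 0 -> k = 0.
Proof.
move=> /eqP; rewrite mulf_eq0 invr_eq0 !subr_eq0 (negPf (natQ_neq1 n_gt1)) orbF.
rewrite -(expr0z n%:R) => /eqP; apply: ieexprIz; last exact: natQ_neq1.
by rewrite ltr0n; lia.
Qed.

(** [dil] and [shift] are the parameters u and v; automorphisms compose like the maps y |-> u y + v,
    as [dilM] and [shiftM] record. *)
Definition dil f : rat := trans (f (bs_a n)).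
Definition shift f : rat := trans (f (bs_t n)).

Lemma aut1 f : f 1%g = 1%g.
Proof. by apply: (@mulgI _ (f 1%g)); rewrite -autM !mulg1. Qed.

Lemma autV f x : f x^-1%g = (f x)^-1%g.
Proof. by apply: (@mulgI _ (f x)); rewrite -autM !mulgV aut1. Qed.

Lemma autX f x m : f (x ^+ m)%g = (f x ^+ m)%g.
Proof. by elim: m => [|m IHm]; rewrite ?aut1 // !expgS autM IHm. Qed.

Lemma heightX (g : BS n) m : height (g ^+ m)%g = height g *+ m.
Proof. by elim: m => [|m IHm]; rewrite ?height1 // expgS heightM // IHm mulrS. Qed.

Lemma transX0 (g : BS n) m : height g = 0 -> trans (g ^+ m)%g = trans g *+ m.
Proof.
move=> g0; elim: m => [|m IHm]; first by rewrite trans1.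
by rewrite expgS transM // IHm g0 expr0z mul1r mulrS.
Qed.

(** Heights in the relation give h = n h, and n > 1. *)
Lemma aut_height_a f : height (f (bs_a n)) = 0.
Proof.
have /(congr1 (@height n \o f)) := bs_relation n.
rewrite /= !autM autV autX !heightM // heightV // heightX addrC addKr -mulr_natl natz.
by move: (height _) => h; nia.
Qed.

Lemma dil_neq0 f : dil f != 0.
Proof.
apply/eqP => d0.
have : f (bs_a n) = f 1%g.
  by apply: bs_eqP => //; rewrite aut1 ?trans1 ?height1 ?aut_height_a.
by move/(bij_inj (aut_bij f))/(congr1 (@trans n)); rewrite trans_a // trans1.
Qed.

(** Translations in the relation give n^e u = n u, where e is the height of the image of t; u can be
    cancelled because f is injective. *)
Lemma aut_height_t f : height (f (bs_t n)) = 1.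
Proof.
have /(congr1 (@trans n \o f)) := bs_relation n.
rewrite /= !autM autV autX transX0 ?aut_height_a // !transM // heightM // transV //.
rewrite aut_height_a addr0 mulrN mulrA -expfzDr ?natQ_neq0 // subrr expr0z mul1r.
rewrite -/(dil f) -/(shift f) addrC addKr -(mulr_natl (dil f)).
move=> /(mulIf (dil_neq0 f)).
rewrite -[RHS]expr1z; apply: ieexprIz; last exact: natQ_neq1.
by rewrite ltr0n; lia.
Qed.

Lemma aut_height f g : height (f g) = height g.
Proof.
pose H : {pred BS n} := fun g => height (f g) == height g.
apply/eqP; apply: (bs_generates (H := H)) => //; last first.
  move=> x; rewrite !inE => /orP[] /eqP ->; rewrite /H unfold_in.
    by rewrite aut_height_a height_a.
  by rewrite aut_height_t height_t.
split=> [|x y]; rewrite /H !unfold_in ?aut1 // => /eqP hx /eqP hy.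
by rewrite autM autV !heightM // !heightV // hx hy.
Qed.

(** By [qintD] the formula cuts out a subgroup; it contains [a] and [t], which generate. *)
Lemma aut_trans f g :
  trans (f g) = dil f * trans g + qint (height g) * shift f.
Proof.
pose H : {pred BS n} := fun g =>
  trans (f g) == dil f * trans g + qint (height g) * shift f.
apply/eqP; apply: (bs_generates (H := H)) => //; last first.
  move=> x; rewrite !inE => /orP[] /eqP ->; rewrite /H unfold_in.
    by rewrite height_a // qint0 mul0r addr0 trans_a // mulr1.
  by rewrite trans_t // mulr0 add0r height_t // qint1 mul1r.
split=> [|x y]; rewrite /H !unfold_in ?aut1 ?trans1 ?height1 ?qint0 ?mulr0 ?mul0r ?addr0 //.
move=> /eqP hx /eqP hy.
rewrite autM autV !transM // !transV // !heightM // !heightV // !aut_height hx hy.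
have qV : qint (- height y) = - (n%:R ^ (- height y) * qint (height y)).
  by apply/eqP; rewrite -subr_eq0 opprK -qintD addNr qint0.
rewrite qintD qV; apply/eqP.
by move: (n%:R ^ height x) (n%:R ^ (- height y)) => A B; ring.
Qed.

Lemma aut_eqP f h : dil f = dil h -> shift f = shift h -> f = h.
Proof.
move=> ed es; apply: autP => g; apply: bs_eqP => //.
  by rewrite !aut_trans ed es.
by rewrite !aut_height.
Qed.

Lemma dilM f h : dil (f * h)%g = dil f * dil h.
Proof.
by rewrite -[LHS]/(trans (f (h _))) aut_trans aut_height height_a // qint0
           mul0r addr0.
Qed.

Lemma shiftM f h : shift (f * h)%g = dil f * shift h + shift f.
Proof.
by rewrite -[LHS]/(trans (f (h _))) aut_trans aut_height height_t // qint1
           mul1r.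
Qed.

Lemma dil1 : dil 1%g = 1. Proof. exact: trans_a. Qed.

Lemma dilV f : dil f^-1%g = (dil f)^-1.
Proof.
apply: (mulfI (dil_neq0 f)); rewrite -dilM mulgV dil1 divff //.
exact: dil_neq0.
Qed.

Lemma dil_Zinv f : dil f \in in_Zinv n. Proof. exact: trans_Zinv. Qed.
Lemma shift_Zinv f : shift f \in in_Zinv n. Proof. exact: trans_Zinv. Qed.

Lemma qint_Zinv k : qint k \in in_Zinv n.
Proof.
have nat_case (m : nat) : qint m \in in_Zinv n.
  elim: m => [|m IHm]; first by rewrite qint0; exact: (Zinv_int _ 0).
  rewrite -addn1 PoszD addrC qintD qint1 -[X in X + _]opprK addrC.
  apply: ZinvB; first by apply: ZinvM => //; exact: Zinv_expz.
  exact: (Zinv_int _ (-1)).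
case: k => [|m]; first exact: nat_case.
have -> : qint (Negz m) = 0 - n%:R ^ (Negz m) * qint m.+1.
  by apply/eqP; rewrite sub0r -subr_eq0 opprK -qintD NegzE addNr qint0.
apply: ZinvB; first exact: (Zinv_int _ 0).
by apply: ZinvM => //; exact: Zinv_expz.
Qed.

Lemma aut_exists u v : u \in in_Zinv n -> u^-1 \in in_Zinv n -> u != 0 ->
  v \in in_Zinv n -> {f | dil f = u & shift f = v}.
Proof.
move=> uZ uVZ u0 vZ.
have val_Zinv w z (g : BS n) : w \in in_Zinv n -> z \in in_Zinv n ->
    w * trans g + qint (height g) * z \in in_Zinv n.
  move=> wZ zZ; rewrite -[X in _ + X]opprK; apply: ZinvB.
    by apply: ZinvM => //; exact: trans_Zinv.
  rewrite -mulN1r; apply: ZinvM; first exact: (Zinv_int _ (-1)).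
  by apply: ZinvM => //; exact: qint_Zinv.
(* Built for arbitrary parameters, so that the inverse is the same construction at (u^-1, - u^-1
   v). *)
pose mk w z (wZ : w \in in_Zinv n) (zZ : z \in in_Zinv n) (g : BS n) :=
  s2val (bs_elt n_gt1 (height g) (val_Zinv w z g wZ zZ)).
have mkT w z wZ zZ g : trans (mk w z wZ zZ g) = w * trans g + qint (height g) * z.
  exact: (s2valP (bs_elt n_gt1 (height g) (val_Zinv w z g wZ zZ))).
have mkH w z wZ zZ g : height (mk w z wZ zZ g) = height g.
  exact: (s2valP' (bs_elt n_gt1 (height g) (val_Zinv w z g wZ zZ))).
have zZ : - (u^-1 * v) \in in_Zinv n.
  rewrite -mulN1r; apply: ZinvM; first exact: (Zinv_int _ (-1)).
  exact: ZinvM.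
have autF : is_aut (mk u v uZ vZ).
  apply/asboolP; split=> [g h|].
    apply: bs_eqP => //; rewrite ?heightM // ?mkH ?heightM //.
    rewrite mkT !transM // !mkT mkH heightM // qintD.
    by move: (n%:R ^ height g) => A; ring.
  exists (mk u^-1 (- (u^-1 * v)) uVZ zZ) => g; apply: bs_eqP => //; rewrite ?mkH //.
    by rewrite !mkT mkH mulrDr mulrA mulVf // mul1r; ring.
  by rewrite !mkT mkH; move: (qint _) => q; field.
exists (MkAut autF).
  by rewrite /dil /= mkT trans_a // height_a // qint0; ring.
by rewrite /shift /= mkT trans_t // height_t // qint1; ring.
Qed.

(** * The stabilizer of a single element *)

Variable g : BS n.
Local Notation x := (trans g).
Local Notation k := (height g).

Lemma stab_eq (f : Stab g) : dil f * x + qint k * shift f = x.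
Proof.
case: f => f /= fg; rewrite -aut_trans; congr trans.
by apply/eqP; exact: fg.
Qed.

Lemma stab_exists u v : u \in in_Zinv n -> u^-1 \in in_Zinv n -> u != 0 ->
  v \in in_Zinv n -> u * x + qint k * v = x ->
  {f : Stab g | dil f = u & shift f = v}.
Proof.
move=> uZ uVZ u0 vZ eqx.
have [f df sf] := aut_exists uZ uVZ u0 vZ.
have fg : f \in stab g.
  rewrite unfold_in; apply/eqP/bs_eqP => //; last exact: aut_height.
  by rewrite aut_trans df sf.
by exists (MkStab fg).
Qed.

Lemma stab_dilM (f h : Stab g) : dil (f * h)%g = dil f * dil h.
Proof. exact: dilM. Qed.

Lemma stab_dil1 : dil (1%g : Stab g) = 1.
Proof. exact: dil1. Qed.

Lemma stab_dilV (f : Stab g) : dil (f^-1)%g = (dil f)^-1.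
Proof. exact: (dilV f). Qed.

(** Once u = 1, [shiftM] becomes additive, so [shift] is the isomorphism. *)
Lemma stab_horizontal : k = 0 -> g <> 1%g -> isomorphic_additive (Stab g) (Zinv n).
Proof.
move=> k0 g1.
have x0 : x != 0.
  by apply/eqP => x0; apply: g1; apply: bs_eqP; rewrite // ?trans1 ?height1.
have dil_stab (f : Stab g) : dil f = 1.
  have /eqP := stab_eq f; rewrite k0 qint0 mul0r addr0 -subr_eq0 -{2}[x]mul1r.
  by rewrite -mulrBl mulf_eq0 (negPf x0) orbF subr_eq0 => /eqP.
have Zinv1 : 1 \in in_Zinv n by exact: (Zinv_int _ 1).
have mkP (v : Zinv n) : 1 * x + qint k * val v = x.
  by rewrite mul1r k0 qint0 mul0r addr0.
have mk (v : Zinv n) : {f : Stab g | dil f = 1 & shift f = val v}.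
  apply: stab_exists (mkP v); rewrite ?invr1 ?oner_eq0 //; exact: valP v.
exists (fun f : Stab g => MkZinv (shift_Zinv f)).
  move=> f h; apply: val_inj => /=.
  by rewrite -[LHS]/(shift (f * h)%g) shiftM dil_stab mul1r addrC.
exists (fun v => s2val (mk v)) => [f|v].
  apply: val_inj; apply: aut_eqP; first by rewrite !dil_stab.
  exact: (s2valP' (mk _)).
by apply: val_inj; exact: (s2valP' (mk v)).
Qed.

Hypothesis k_neq0 : k != 0.

(** As [k] is nonzero, the stabilizer equation determines v from u; thus [dil] embeds the stabilizer
    in the multiplicative group of Q. *)
Lemma stab_eqP (f h : Stab g) : dil f = dil h -> f = h.
Proof.
move=> dfh; apply: val_inj; apply: aut_eqP => //.
have qk : qint k != 0 by apply: contraNneq k_neq0 => /qint_eq0 ->.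
apply: (mulfI qk); apply: (@addrI _ (dil f * x)).
by rewrite stab_eq dfh stab_eq.
Qed.

Lemma stab_abelian : abelian_group (Stab g).
Proof. by move=> f h; apply: stab_eqP; rewrite !stab_dilM mulrC. Qed.

End AutBS.

(** * Recursive functions *)

(** The size condition restores the arity that [recfun] leaves open. Predicates are covered through
    the coercion of booleans to 0 and 1. *)
Definition recursive (A : nat) (F : seq nat -> nat) : Prop :=
  exists p, forall v, size v = A -> computes p v (F v).

Lemma recursive_ext A F G :
  (forall v, size v = A -> F v = G v) -> recursive A F -> recursive A G.
Proof. by move=> FG [p Fp]; exists p => v sv; rewrite -FG //; apply: Fp. Qed.

Lemma recursive_proj A i : recursive A (fun v => nth 0 v i).
Proof. by exists (RProj i). Qed.

Lemma recursive_proj_drop A k i : recursive A (fun v => nth 0 (drop k v) i).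
Proof. by apply: recursive_ext (recursive_proj A (k + i)) => v _; rewrite nth_drop. Qed.

Lemma recursive_succ A F : recursive A F -> recursive A (fun v => (F v).+1).
Proof.
move=> [p Fp]; exists (RComp RSucc [:: p]) => v sv /=.
by exists [:: F v] => //; split=> //; apply: Fp.
Qed.

Lemma recursive_const A c : recursive A (fun=> c).
Proof. by elim: c => [|c /recursive_succ //]; exists RZero. Qed.

Lemma recursive_comp A B F (Gs : seq (seq nat -> nat)) :
  recursive B F -> size Gs = B ->
  (forall i, i < size Gs -> recursive A (nth (fun=> 0) Gs i)) ->
  recursive A (fun v => F [seq G v | G <- Gs]).
Proof.
move=> [p Fp] sGs GsR.
suff [ps psP] : exists ps, forall v, size v = A ->
    (fix computes_all (gs : seq recfun) (ws : seq nat) {struct gs} : Prop :=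
       match gs, ws with
       | [::], [::] => True
       | h :: gs', w :: ws' => computes h v w /\ computes_all gs' ws'
       | _, _ => False
       end) ps [seq G v | G <- Gs].
  exists (RComp p ps) => v sv /=; exists [seq G v | G <- Gs]; first exact: psP.
  by apply: Fp; rewrite size_map.
elim: Gs {sGs} GsR => [|G Gs IHGs] GsR; first by exists [::].
have [q qP] := GsR 0 isT.
have [|ps psP] := IHGs; first by move=> i; apply: (GsR i.+1).
by exists (q :: ps) => v sv /=; split; [apply: qP | apply: psP].
Qed.

Definition recursive1 (f : nat -> nat) := recursive 1 (fun v => f (nth 0 v 0)).
Definition recursive2 (f : nat -> nat -> nat) :=
  recursive 2 (fun v => f (nth 0 v 0) (nth 0 v 1)).
Definition recursive3 (f : nat -> nat -> nat -> nat) :=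
  recursive 3 (fun v => f (nth 0 v 0) (nth 0 v 1) (nth 0 v 2)).

Lemma recursive_app1 f A F :
  recursive1 f -> recursive A F -> recursive A (fun v => f (F v)).
Proof.
move=> fR FR; apply: (recursive_comp (Gs := [:: F]) fR) => //.
by case.
Qed.

Lemma recursive_app2 f A F G :
  recursive2 f -> recursive A F -> recursive A G ->
  recursive A (fun v => f (F v) (G v)).
Proof.
move=> fR FR GR; apply: (recursive_comp (Gs := [:: F; G]) fR) => //.
by case=> [|[]].
Qed.

Lemma recursive_app3 f A F G H :
  recursive3 f -> recursive A F -> recursive A G -> recursive A H ->
  recursive A (fun v => f (F v) (G v) (H v)).
Proof.
move=> fR FR GR HR; apply: (recursive_comp (Gs := [:: F; G; H]) fR) => //.
by case=> [|[|[]]].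
Qed.

Lemma recursive_cons A m F :
  recursive A m -> recursive A.+1 F -> recursive A (fun v => F (m v :: v)).
Proof.
move=> mR FR.
apply: (@recursive_ext _ (fun v =>
  F [seq G v | G <- m :: [seq nth 0 ^~ i | i <- iota 0 A]])).
  move=> v sv; rewrite /= -map_comp; congr (F (_ :: _)).
  apply: (@eq_from_nth _ 0); rewrite size_map size_iota ?sv //.
  by move=> i iA; rewrite (nth_map 0) ?size_iota // nth_iota.
apply: recursive_comp FR _ _; first by rewrite /= size_map size_iota.
case=> [|i] //=; rewrite size_map size_iota ltnS => iA.
by rewrite (nth_map 0) ?size_iota // nth_iota //; exact: recursive_proj.
Qed.

(** Inserts a dummy second variable, the place where [recursive_prim] puts the accumulator of a
    loop. *)
Lemma recursive_skip A (F : nat -> seq nat -> nat) :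
  recursive A.+1 (fun v => F (nth 0 v 0) (drop 1 v)) ->
  recursive A.+2 (fun v => F (nth 0 v 0) (drop 2 v)).
Proof.
move=> FR; apply: (@recursive_ext _ (fun v => (fun w => F (nth 0 w 0) (drop 1 w))
   [seq G v | G <- nth 0 ^~ 0 :: [seq nth 0 ^~ i.+2 | i <- iota 0 A]])).
  move=> v sv; rewrite /= -map_comp !drop0; congr F.
  apply: (@eq_from_nth _ 0); rewrite size_map size_iota ?size_drop ?sv ?subn2 //.
  by move=> i iA; rewrite (nth_map 0) ?size_iota // nth_iota // nth_drop.
apply: recursive_comp FR _ _; first by rewrite /= size_map size_iota.
case=> [|i] /=; first by move=> _; exact: recursive_proj.
rewrite size_map size_iota ltnS => iA.
by rewrite (nth_map 0) ?size_iota // nth_iota //; exact: recursive_proj.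
Qed.

Fixpoint prim_rec (b : nat) (h : nat -> nat -> nat) (m : nat) : nat :=
  if m is m'.+1 then h m' (prim_rec b h m') else b.

Lemma recursive_prim A m b (h : nat -> nat -> seq nat -> nat) :
  recursive A m -> recursive A b ->
  recursive A.+2 (fun v => h (nth 0 v 0) (nth 0 v 1) (drop 2 v)) ->
  recursive A (fun v => prim_rec (b v) (fun i z => h i z v) (m v)).
Proof.
move=> mR [q qP] [r rP].
apply: (@recursive_cons _ m (fun v =>
  prim_rec (b (behead v)) (fun i z => h i z (behead v)) (head 0 v))) => //.
exists (RPrim q r) => -[|k v] //= [sv]; elim: k => [|k IHk] /=; first exact: qP.
exists (prim_rec (b v) (fun i z => h i z v) k) => //.
have := rP [:: k, prim_rec (b v) (fun i z => h i z v) k & v].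
by rewrite /= drop0 sv; apply.
Qed.

(** [RMin] finds the least zero, and a failed test has value 0; so F v is found as the first z at
    which [T] fails. *)
Lemma recursive_min A F (T : nat -> seq nat -> bool) :
  recursive A.+1 (fun v => T (nth 0 v 0) (behead v)) ->
  (forall z v, size v = A -> T z v = (z < F v)) ->
  recursive A F.
Proof.
move=> [q qP] TF; exists (RMin q) => v sv /=; split.
  by have := qP (F v :: v); rewrite /= sv TF // ltnn => /(_ erefl).
move=> z zF; exists 0.
by have := qP (z :: v); rewrite /= sv TF // zF => /(_ erefl).
Qed.

(** * Arithmetic functions *)

Lemma recursive_pred : recursive1 predn.
Proof.
apply: (@recursive_ext _ (fun v => prim_rec 0 (fun i z => i) (nth 0 v 0))).
  by move=> v _; case: (nth 0 v 0).
by apply: recursive_prim; [exact: recursive_proj | exact: recursive_const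
  | exact: recursive_proj].
Qed.

Lemma recursive_addn : recursive2 addn.
Proof.
apply: (@recursive_ext _ (fun v =>
  prim_rec (nth 0 v 0) (fun i z => z.+1) (nth 0 v 1))).
  by move=> v _; elim: (nth 0 v 1) => [|k /= ->]; rewrite ?addn0 ?addnS.
by apply: recursive_prim; [exact: recursive_proj | exact: recursive_proj
  | apply: recursive_succ; exact: recursive_proj].
Qed.

Lemma recursive_subn : recursive2 subn.
Proof.
apply: (@recursive_ext _ (fun v =>
  prim_rec (nth 0 v 0) (fun i z => z.-1) (nth 0 v 1))).
  by move=> v _; elim: (nth 0 v 1) => [|k /= ->]; rewrite ?subn0 ?subnS.
by apply: recursive_prim; [exact: recursive_proj | exact: recursive_proj
  | apply: (recursive_app1 recursive_pred); exact: recursive_proj].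
Qed.

Lemma recursive_muln : recursive2 muln.
Proof.
apply: (@recursive_ext _ (fun v =>
  prim_rec 0 (fun i z => z + nth 0 v 0) (nth 0 v 1))).
  by move=> v _; elim: (nth 0 v 1) => [|k /= ->]; rewrite ?muln0 // mulnS addnC.
apply: (recursive_prim (h := fun i z v => z + nth 0 v 0));
  [exact: recursive_proj | exact: recursive_const | ].
apply: (recursive_app2 recursive_addn); first exact: recursive_proj.
exact: recursive_proj_drop.
Qed.

Lemma recursive_expn : recursive2 expn.
Proof.
apply: (@recursive_ext _ (fun v =>
  prim_rec 1 (fun i z => nth 0 v 0 * z) (nth 0 v 1))).
  by move=> v _; elim: (nth 0 v 1) => [|k /= ->]; rewrite ?expn0 // expnS.
apply: (recursive_prim (h := fun i z v => nth 0 v 0 * z));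
  [exact: recursive_proj | exact: recursive_const | ].
apply: (recursive_app2 recursive_muln); last exact: recursive_proj.
exact: recursive_proj_drop.
Qed.

Lemma recursive_fact : recursive1 factorial.
Proof.
apply: (@recursive_ext _ (fun v =>
  prim_rec 1 (fun i z => i.+1 * z) (nth 0 v 0))).
  by move=> v _; elim: (nth 0 v 0) => [|k /= ->]; rewrite ?factS.
apply: recursive_prim; [exact: recursive_proj | exact: recursive_const | ].
apply: (recursive_app2 recursive_muln); last exact: recursive_proj.
by apply: recursive_succ; exact: recursive_proj.
Qed.

Lemma recursive_leq : recursive2 (fun x y => x <= y).
Proof.
apply: (@recursive_ext _ (fun v => 1 - (nth 0 v 0 - nth 0 v 1))).
  by move=> v _; rewrite /leq; case: (nth 0 v 0 - nth 0 v 1).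
apply: (recursive_app2 recursive_subn); first exact: recursive_const.
by apply: (recursive_app2 recursive_subn); exact: recursive_proj.
Qed.

Lemma recursive_and A (P Q : seq nat -> bool) :
  recursive A P -> recursive A Q -> recursive A (fun v => P v && Q v).
Proof.
move=> PR QR; apply: (@recursive_ext _ (fun v => P v * Q v)).
  by move=> v _; rewrite mulnb.
exact: (recursive_app2 recursive_muln).
Qed.

Lemma recursive_eq : recursive2 (fun x y => x == y).
Proof.
apply: (@recursive_ext _ (fun v =>
  (nth 0 v 0 <= nth 0 v 1) && (nth 0 v 1 <= nth 0 v 0))).
  by move=> v _; rewrite eqn_leq.
by apply: recursive_and; apply: (recursive_app2 recursive_leq);
  exact: recursive_proj.
Qed.

Lemma recursive_if A (P : seq nat -> bool) F G :
  recursive A P -> recursive A F -> recursive A G ->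
  recursive A (fun v => if P v then F v else G v).
Proof.
move=> PR FR GR; apply: (@recursive_ext _ (fun v => P v * F v + (1 - P v) * G v)).
  by move=> v _; case: (P v); rewrite ?mul1n ?mul0n ?addn0.
apply: (recursive_app2 recursive_addn); apply: (recursive_app2 recursive_muln) => //.
by apply: (recursive_app2 recursive_subn) => //; exact: recursive_const.
Qed.

(** The quotient is the least z with x < (z+1) d. For d = 0 the guard stops the search at once,
    matching the convention x %/ 0 = 0. *)
Lemma recursive_divn : recursive2 divn.
Proof.
apply: (recursive_min (T := fun z v =>
  (0 < nth 0 v 1) && (z.+1 * nth 0 v 1 <= nth 0 v 0))); last first.
  move=> z [|x [|[|d] []]] //= _.
  by rewrite leq_divRL.
have projb i : recursive 3 (fun v => nth 0 (behead v) i).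
  by apply: recursive_ext (recursive_proj 3 i.+1) => v _; rewrite nth_behead.
apply: recursive_and; apply: (recursive_app2 recursive_leq) => //.
  exact: recursive_const.
apply: (recursive_app2 recursive_muln) => //.
by apply: recursive_succ; exact: recursive_proj.
Qed.

Lemma recursive_modn : recursive2 modn.
Proof.
apply: (@recursive_ext _ (fun v =>
  nth 0 v 0 - nth 0 v 0 %/ nth 0 v 1 * nth 0 v 1)).
  by move=> v _; rewrite {1}(divn_eq (nth 0 v 0) (nth 0 v 1)) addKn.
apply: (recursive_app2 recursive_subn); first exact: recursive_proj.
apply: (recursive_app2 recursive_muln); last exact: recursive_proj.
by apply: (recursive_app2 recursive_divn); exact: recursive_proj.
Qed.

Lemma recursive_dvdn : recursive2 dvdn.
Proof.
apply: (recursive_app2 recursive_eq); last exact: recursive_const.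
by apply: (recursive_app2 recursive_modn); exact: recursive_proj.
Qed.

(** Every power of 2 divides 0, so the guard is what ends the search there, with the conventional
    value 0. *)
Lemma recursive_logn2 : recursive1 (logn 2).
Proof.
apply: (recursive_min (T := fun z v =>
  (0 < nth 0 v 0) && (2 ^ z.+1 %| nth 0 v 0))); last first.
  move=> z [|[|x] []] //= _.
  by rewrite pfactor_dvdn.
have projb i : recursive 2 (fun v => nth 0 (behead v) i).
  by apply: recursive_ext (recursive_proj 2 i.+1) => v _; rewrite nth_behead.
apply: recursive_and.
  by apply: (recursive_app2 recursive_leq) => //; exact: recursive_const.
apply: (recursive_app2 recursive_dvdn) => //.
apply: (recursive_app2 recursive_expn); first exact: recursive_const.
by apply: recursive_succ; exact: recursive_proj.
Qed.

Lemma recursive_sum A m (F : nat -> seq nat -> nat) :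
  recursive A m -> recursive A.+1 (fun v => F (nth 0 v 0) (drop 1 v)) ->
  recursive A (fun v => \sum_(i < m v) F i v).
Proof.
move=> mR FR; apply: (@recursive_ext _ (fun v =>
    prim_rec 0 (fun i z => z + F i v) (m v))).
  move=> v _; elim: (m v) => [|k IHk] /=; first by rewrite big_ord0.
  by rewrite big_ord_recr IHk.
apply: (recursive_prim (h := fun i z v => z + F i v)) => //.
  exact: recursive_const.
apply: (recursive_app2 recursive_addn); first exact: recursive_proj.
exact: recursive_skip FR.
Qed.

(** * Codes of sequences and words *)

Definition code_cons (h c : nat) : nat := 2 ^ h * (2 * c).+1.

Lemma code_consE h s : CodeSeq.code (h :: s) = code_cons h (CodeSeq.code s).
Proof. by rewrite /= -mul2n. Qed.

Lemma recursive_code_cons : recursive2 code_cons.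
Proof.
apply: (recursive_app2 recursive_muln).
  apply: (recursive_app2 recursive_expn); last exact: recursive_proj.
  exact: recursive_const.
apply: recursive_succ; apply: (recursive_app2 recursive_muln).
  exact: recursive_const.
exact: recursive_proj.
Qed.

(** In the code 2^h (2 c + 1) the 2-adic valuation is the head h, and the rounded quotient by
    2^(h+1) is the code c of the tail. The code 0 of the empty sequence is fixed. *)
Definition code_behead (c : nat) : nat := c %/ 2 ^ (logn 2 c).+1.

Lemma logn2_code_cons h c : logn 2 (code_cons h c) = h.
Proof.
rewrite /code_cons lognM ?expn_gt0 // pfactorK // [logn 2 _.+1]lognE /=.
by rewrite dvdn2 /= oddM /= addn0.
Qed.

Lemma code_consK h c : code_behead (code_cons h c) = c.
Proof.
rewrite /code_behead logn2_code_cons /code_cons expnS mulnC divnMr ?expn_gt0 //.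
by rewrite -addn1 mulnC divnMDl // addn0.
Qed.

Lemma recursive_code_behead : recursive1 code_behead.
Proof.
apply: (recursive_app2 recursive_divn); first exact: recursive_proj.
apply: (recursive_app2 recursive_expn); first exact: recursive_const.
by apply: recursive_succ; apply: (recursive_app1 recursive_logn2);
  exact: recursive_proj.
Qed.

Definition recursive_word A (W : seq nat -> bs_word) :=
  recursive A (fun v => code_word (W v)).

Lemma recursive_word_nseq A m W l :
  recursive A m -> recursive_word A W ->
  recursive_word A (fun v => nseq (m v) l ++ W v).
Proof.
move=> mR WR; apply: (@recursive_ext _ (fun v =>
    prim_rec (code_word (W v)) (fun i z => code_cons (code_letter l) z) (m v))).
  move=> v _; elim: (m v) => [|k IHk] //=.
  by rewrite IHk /code_word -code_consE.
apply: recursive_prim => //.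
apply: (recursive_app2 recursive_code_cons); first exact: recursive_const.
exact: recursive_proj.
Qed.

(** A loop counting upwards conses the largest index last, whence the reversed [iota]. *)
Lemma recursive_code_filter A m (T : nat -> seq nat -> bool)
    (F : nat -> seq nat -> nat) :
  recursive A m ->
  recursive A.+1 (fun v => T (nth 0 v 0) (drop 1 v)) ->
  recursive A.+1 (fun v => F (nth 0 v 0) (drop 1 v)) ->
  recursive A (fun v =>
    CodeSeq.code [seq F i v | i <- rev (iota 0 (m v)) & T i v]).
Proof.
move=> mR TR FR; apply: (@recursive_ext _ (fun v =>
    prim_rec 0 (fun i z => if T i v then code_cons (F i v) z else z) (m v))).
  move=> v _; elim: (m v) => [|k IHk] //.
  rewrite -addn1 iotaD cats1 rev_rcons addn1 [LHS]/= IHk /= add0n.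
  by case: (T k v) => //=; rewrite /code_cons mul2n.
apply: (recursive_prim (h := fun i z v => if T i v then code_cons (F i v) z else z)) => //.
  exact: recursive_const.
apply: recursive_if; first exact: (recursive_skip (F := fun i v => T i v)).
  apply: (recursive_app2 recursive_code_cons); first exact: recursive_skip.
  exact: recursive_proj.
exact: recursive_proj.
Qed.


(** * Units of Z[1/n] *)

Section PadicValuation.
Local Open Scope ring_scope.
Variable p : nat.

(** The p-adic valuation for prime p, with value 0 at q = 0. *)
Definition ratval (q : rat) : int :=
  (logn p `|numq q|)%:Z - (logn p `|denq q|)%:Z.

Lemma ratval_frac (a b : int) : a != 0 -> b != 0 ->
  ratval (a%:~R / b%:~R) = (logn p `|a|)%:Z - (logn p `|b|)%:Z.
Proof.
move=> a0 b0; set q := _ / _.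
have q0 : q != 0 by rewrite mulf_neq0 ?invr_eq0 ?intr_eq0.
have eq_abs : (`|a| * `|denq q| = `|numq q| * `|b|)%N.
  rewrite -!abszM; congr absz; apply: (@intr_inj rat); rewrite !rmorphM /= numqE.
  by rewrite mulrAC /q divfK // intr_eq0.
have := congr1 (logn p) eq_abs; rewrite !lognM ?absz_gt0 ?denq_neq0 ?numq_eq0 //.
by rewrite /ratval; lia.
Qed.

Lemma ratvalM q r : q != 0 -> r != 0 -> ratval (q * r) = ratval q + ratval r.
Proof.
move=> q0 r0; have -> : q * r = (numq q * numq r)%:~R / (denq q * denq r)%:~R.
  by rewrite !rmorphM /= -mulf_div !divq_num_den.
rewrite ratval_frac ?mulf_neq0 ?numq_eq0 ?denq_neq0 // !abszM.
by rewrite !lognM ?absz_gt0 ?numq_eq0 ?denq_neq0 // /ratval; lia.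
Qed.

Lemma ratval_nat m : ratval m%:R = logn p m.
Proof.
have [->|m0] := eqVneq m 0%N; first by rewrite /ratval logn0 logn1.
have -> : m%:R = (m%:Z)%:~R / 1%:~R :> rat by rewrite divr1.
by rewrite ratval_frac //= logn1 subr0.
Qed.

Lemma ratval1 : ratval 1 = 0.
Proof. by rewrite (ratval_nat 1) logn1. Qed.

Lemma ratvalV q : q != 0 -> ratval q^-1 = - ratval q.
Proof.
move=> q0; have q_qV : ratval (q^-1 * q) = ratval q^-1 + ratval q.
  by rewrite ratvalM ?invr_eq0.
by apply: (@addIr _ (ratval q)); rewrite -q_qV mulVf // ratval1 addNr.
Qed.

Lemma ratvalXz q (m : int) : q != 0 -> ratval (q ^ m) = m * ratval q.
Proof.
move=> q0; have natX (i : nat) : ratval (q ^+ i) = i%:Z * ratval q.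
  elim: i => [|i IHi]; first by rewrite ratval1 mul0r.
  by rewrite exprS ratvalM ?expf_neq0 // IHi intS mulrDl mul1r.
case: m => i; first exact: natX.
by rewrite NegzE -exprnN ratvalV ?expf_neq0 // natX mulNr.
Qed.

Lemma ratval_prod (I : finType) (F : I -> rat) : (forall i, F i != 0) ->
  ratval (\prod_i F i) = \sum_i ratval (F i).
Proof.
move=> F0; suff [] : \prod_i F i != 0 /\ ratval (\prod_i F i) = \sum_i ratval (F i) by [].
apply: (big_ind2 (fun a b => a != 0 /\ ratval a = b)) => //.
- by rewrite ratval1.
- by move=> a b c d [a0 <-] [c0 <-]; rewrite mulf_neq0 // ratvalM.
Qed.

End PadicValuation.

Section ZinvUnits.
Local Open Scope ring_scope.
Variable n : nat.
Hypothesis n_gt1 : (1 < n)%N.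
Variable u : rat.
Hypotheses (u_neq0 : u != 0) (uZ : u \in in_Zinv n) (uVZ : u^-1 \in in_Zinv n).

(** Only primes dividing n occur in a unit of Z[1/n], so u is 1 or -1; squaring absorbs the sign. *)
Lemma ratval_unit_sqr : (forall p, p \in primes n -> ratval p u = 0) -> u ^+ 2 = 1.
Proof.
move=> val0.
have nX0 e : (n%:R : rat) ^+ e != 0 by rewrite expf_neq0 ?natQ_neq0.
(* Applied to numerator and denominator of u in both orders: a prime divisor of one is prime to the
   other, so it divides n. *)
have dvd_prime (p : nat) (e : nat) (a b c : int) : prime p ->
    (p %| `|a|)%N -> coprime `|a| `|b| -> c * a = b * n%:Z ^+ e -> p \in primes n.
  move=> p_pr pa ab /(congr1 absz); rewrite !abszM => eq_abs.
  have : (p %| `|c| * `|a|)%N by rewrite dvdn_mull.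
  rewrite eq_abs Euclid_dvdM // => /orP[pb|].
    have : (p %| gcdn `|a| `|b|)%N by rewrite dvdn_gcd pa.
    by rewrite (eqP ab) dvdn1 => /eqP p1; rewrite p1 in p_pr.
  rewrite abszX Euclid_dvdX // => /andP[pn _].
  by rewrite mem_primes p_pr pn /= andbT; lia.
have num1 : `|numq u|%N = 1%N.
  apply/eqP; apply: contraT => num_neq1.
  have p_pr : prime (pdiv `|numq u|).
    by rewrite pdiv_prime // ltn_neqAle eq_sym num_neq1 absz_gt0 numq_eq0.
  have pnum := pdiv_dvd `|numq u|; set p := pdiv _ in p_pr pnum.
  have [l [e eq_uV]] := in_ZinvP _ _ uVZ.
  have pn : p \in primes n.
    apply: (dvd_prime p e (numq u) (denq u) l) => //; first exact: coprime_num_den.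
    apply: (@intr_inj rat); rewrite !rmorphM rmorphXn /= numqE -pmulrn.
    have -> : l%:~R = u^-1 * n%:R ^+ e by rewrite eq_uV divfK.
    by rewrite mulrACA mulVf // mul1r mulrC.
  have := val0 p pn; rewrite /ratval.
  have -> : logn p `|denq u| = 0%N.
    apply/eqP; rewrite -leqn0 leqNgt logn_gt0 mem_primes negb_and p_pr /=.
    rewrite absz_gt0 denq_neq0 /=; apply/negP => pden.
    have : (p %| gcdn `|numq u| `|denq u|)%N by rewrite dvdn_gcd pnum.
    by rewrite (eqP (coprime_num_den u)) dvdn1 => /eqP p1; rewrite p1 in p_pr.
  have : (0 < logn p `|numq u|)%N by rewrite logn_gt0 mem_primes p_pr pnum absz_gt0 numq_eq0 u_neq0.
  by lia.
have den1 : `|denq u|%N = 1%N.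
  apply/eqP; apply: contraT => den_neq1.
  have p_pr : prime (pdiv `|denq u|).
    by rewrite pdiv_prime // ltn_neqAle eq_sym den_neq1 absz_gt0 denq_neq0.
  have pden := pdiv_dvd `|denq u|; set p := pdiv _ in p_pr pden.
  have [l [e eq_u]] := in_ZinvP _ _ uZ.
  have pn : p \in primes n.
    apply: (dvd_prime p e (denq u) (numq u) l) => //.
      by rewrite coprime_sym; exact: coprime_num_den.
    apply: (@intr_inj rat); rewrite !rmorphM rmorphXn /= numqE -pmulrn.
    have -> : l%:~R = u * n%:R ^+ e by rewrite [in RHS]eq_u divfK.
    by rewrite mulrAC.
  have := val0 p pn; rewrite /ratval num1 logn1.
  have : (0 < logn p `|denq u|)%N by rewrite logn_gt0 mem_primes p_pr pden absz_gt0 denq_neq0.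
  by lia.
have sqr1 (z : int) : `|z|%N = 1%N -> z%:~R ^+ 2 = 1 :> rat.
  by move=> z1; have [->|->] : z = 1 \/ z = -1 by lia.
by rewrite -(divq_num_den u) expr_div_n !sqr1 // divr1.
Qed.

Lemma int_unit_dvd (z : int) : u = z%:~R -> exists e, (`|z| %| n ^ e)%N.
Proof.
move=> u_z; have [l [e eq_uV]] := in_ZinvP _ _ uVZ; exists e.
have : n%:Z ^+ e = l * z.
  apply: (@intr_inj rat); rewrite rmorphM rmorphXn /= -pmulrn -u_z.
  apply: (mulfI (invr_neq0 u_neq0)).
  by rewrite mulrCA mulVf // mulr1 eq_uV divfK // expf_neq0 ?natQ_neq0.
move=> /(congr1 absz); rewrite abszX abszM => ->.
exact: dvdn_mull.
Qed.

End ZinvUnits.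

(** * The stabilizer of an element of nonzero height *)

Section StabUnits.
Local Open Scope ring_scope.
Variables (n : nat) (g : BS n).
Hypotheses (n_gt1 : (1 < n)%N) (k_neq0 : height g != 0).
Variables (y : int) (N j : nat).
Hypotheses (N_gt0 : (0 < N)%N) (N_coprime : coprime n N).
Hypothesis defx : trans g / qint n (height g) = y%:~R / (N%:R * n%:R ^+ j).
Implicit Types f h : Stab g.

Let qk_neq0 : qint n (height g) != 0.
Proof. by apply: contraNneq k_neq0 => /(qint_eq0 n_gt1) ->. Qed.

Let nX_neq0 e : (n%:R : rat) ^+ e != 0.
Proof. by rewrite expf_neq0 ?natQ_neq0. Qed.

Let N_neq0 : (N%:R : rat) != 0.
Proof. by rewrite pnatr_eq0 -lt0n. Qed.

Lemma stab_shift f :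
  shift f = (1 - dil f) * y%:~R / (N%:R * n%:R ^+ j).
Proof.
have eq_x := stab_eq n_gt1 f; apply: (mulIf qk_neq0).
rewrite -[X in _ = X * _]mulrA -defx -mulrA divfK // mulrBl mul1r -[X in X - _]eq_x.
by rewrite addrC addKr mulrC.
Qed.

Lemma stab_of_unit u : u \in in_Zinv n -> u^-1 \in in_Zinv n -> u != 0 ->
  (1 - u) * y%:~R / (N%:R * n%:R ^+ j) \in in_Zinv n ->
  exists f, dil f = u.
Proof.
move=> uZ uVZ u0 vZ.
have eq_x : u * trans g +
    qint n (height g) * ((1 - u) * y%:~R / (N%:R * n%:R ^+ j)) = trans g.
  rewrite -[X in qint n _ * X]mulrA -defx.
  by move: (qint _ _) qk_neq0 => q q0; field.
by have [f df _] := stab_exists n_gt1 uZ uVZ u0 vZ eq_x; exists f.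
Qed.

(** Clearing denominators gives N | n^e (1 - z) y, and N is prime to n. *)
Lemma stab_dil_int f (z : int) : dil f = z%:~R -> (N %| (1 - z) * y)%Z.
Proof.
move=> df; have /in_ZinvP[l [e]] := shift_Zinv n_gt1 f.
rewrite stab_shift df => eq_v.
have eq_int : n%:Z ^+ e * ((1 - z) * y) = N%:Z * (l * n%:Z ^+ j).
  apply: (@intr_inj rat); rewrite !rmorphM !rmorphXn rmorphB /= -!pmulrn.
  have -> : (1 - z%:~R) * y%:~R =
            (l%:~R / n%:R ^+ e) * (N%:R * n%:R ^+ j) :> rat.
    by rewrite -eq_v divfK // mulf_neq0.
  by move: (n%:R ^+ e) (nX_neq0 e) (n%:R ^+ j) => E E0 F; field.
have : (N%:Z %| n%:Z ^+ e * ((1 - z) * y))%Z by rewrite eq_int dvdz_mulr.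
by rewrite Gauss_dvdzr // coprimezXr // coprimezE coprime_sym.
Qed.

Lemma stab_power b : (b %| n)%N -> exists f, dil f = b%:R ^+ N`!.
Proof.
move=> bn; have /dvdnP[c def_n] := bn.
have b_gt0 : (0 < b)%N by apply: dvdn_gt0 bn; lia.
have bQ0 : (b%:R : rat) != 0 by rewrite pnatr_eq0 -lt0n.
have b_coprime : coprime b N by apply: coprime_dvdl N_coprime.
have /eqP : (b ^ N`! = 1 %[mod N])%N.
  (* The totient counts residues among N of them, so it is at most N and divides N!. *)
  have /dvdnP[q ->] : (totient N %| N`!)%N.
    rewrite dvdn_fact // totient_gt0 N_gt0 /= totient_count_coprime.
    rewrite -[leqRHS](subn0 N) -[leqRHS]mul1n mulnC -sum_nat_const_nat.
    by apply: leq_sum => i _; exact: leq_b1.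
  by rewrite mulnC expnM -modnXm (cyclic.Euler_exp_totient b_coprime) modnXm exp1n.
rewrite eqn_mod_dvd ?expn_gt0 ?b_gt0 // => /dvdnP[q def_q].
apply: stab_of_unit; rewrite ?expf_neq0 //.
- by have := Zinv_int n (b ^ N`!)%N; rewrite -pmulrn natrX.
(* With n = c b, the inverse of b^M is c^M / n^M. *)
- apply/in_ZinvP; exists (c ^ N`!)%N%:Z, N`!.
  rewrite -pmulrn natrX def_n natrM exprMn invfM mulrA mulfV ?mul1r //.
  by rewrite expf_neq0 // pnatr_eq0; apply: contraTneq n_gt1 => c0; rewrite def_n c0.
- apply/in_ZinvP; exists (- q%:Z * y), j; rewrite rmorphM rmorphN /= -pmulrn.
  have -> : 1 - b%:R ^+ N`! = - (q%:R * N%:R) :> rat.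
    rewrite -natrM -def_q natrB ?expn_gt0 ?b_gt0 // natrX opprB //.
  by field; rewrite N_neq0 nX_neq0.
Qed.

Let dil_neq0' f : dil f != 0. Proof. exact: dil_neq0. Qed.

Lemma stab_dilX f m : dil (f ^+ m)%g = dil f ^+ m.
Proof.
elim: m => [|m IHm]; first exact: stab_dil1.
by rewrite expgS stab_dilM // IHm exprS.
Qed.

Lemma stab_dilXz f m : dil (expgz f m) = dil f ^ m.
Proof.
by case: m => m; rewrite /= ?stab_dilV // stab_dilX ?NegzE -?exprnN.
Qed.

Lemma stab_dil_prod r (F : 'I_r -> Stab g) :
  dil (\prod_i F i)%g = \prod_i dil (F i).
Proof.
by apply: (big_morph (fun f : Stab g => dil f)); [exact: stab_dilM | exact: stab_dil1].
Qed.

(** Descent on |z|. If |z| does not divide n^M, M = N!, then some prime p dividing n has valuation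
    in z above M v_p(n) >= M, so p^M can be divided out of z. As p^M divides n^M, the element
    divided out lies in [s]. *)
Lemma stab_generates (s : seq (Stab g)) :
  (forall f (z : int), dil f = z%:~R -> (`|z| %| n ^ N`!)%N -> f \in s) ->
  generates s.
Proof.
move=> s_div H Hgrp sH.
have HM f h : f \in H -> h \in H -> (f * h)%g \in H by exact: group_closedM.
have HV f : f \in H -> (f^-1)%g \in H by exact: group_closedV.
have int_in m f (z : int) : (`|z| <= m)%N -> dil f = z%:~R -> f \in H.
  elim: m f z => [|m IHm] f z.
    rewrite leqn0 absz_eq0 => /eqP -> f0.
    by have := dil_neq0' f; rewrite f0 eqxx.
  move=> zm df.
  have z0 : z != 0 by apply: contra_neq (dil_neq0' f); rewrite df => ->.
  have [zn|] := boolP (`|z| %| n ^ N`!)%N; first by apply: sH; apply: s_div df zn.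
  have [||e ze] := @int_unit_dvd n n_gt1 (dil f) _ _ z df => //.
    by rewrite -stab_dilV //; exact: dil_Zinv.
  move/(elimN (dvdn_partP _ _)); rewrite absz_gt0 => /(_ z0) not_dvd.
  have [p pz np] : exists2 p, p \in \pi(`|z|%N) & ~~ (`|z|`_p %| n ^ N`!)%N.
    by apply: contrapT => no_p; apply: not_dvd => p pz; apply: contrapT => /negP np;
      apply: no_p; exists p.
  have p_pr : prime p by move: pz; rewrite mem_primes => /andP[].
  have pn : (p %| n)%N.
    have : (p %| n ^ e)%N by apply: dvdn_trans ze; move: pz; rewrite mem_primes => /and3P[].
    by rewrite Euclid_dvdX // => /andP[].
  have : (p ^ N`! %| `|z|)%N.
    move: np; rewrite p_part !pfactor_dvdn ?expn_gt0 ?absz_gt0 // ?(ltnW n_gt1) //.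
    rewrite -ltnNge lognX; apply: leq_trans; apply: leqW; rewrite leq_pmulr //.
    by rewrite logn_gt0 mem_primes p_pr pn ltnW.
  case/dvdnP => z' def_z.
  have [h dh] := stab_power pn.
  have hH : h \in H.
    by apply/sH/(s_div _ (p ^ N`!)%N); rewrite ?dh -?pmulrn ?natrX // dvdn_exp2r.
  rewrite -(mulgVK h f); apply: HM => //.
  have sz : z = sgz z * z'%:Z * (p ^ N`!)%N%:Z.
    by rewrite -mulrA -PoszM -def_z {1}[z]intEsg.
  apply: (IHm _ (sgz z * z')).
    rewrite abszM absz_sg z0 mul1n /= -ltnS; apply: leq_trans zm.
    rewrite def_z -[X in (X < _)%N]muln1 ltn_pmul2l.
      by rewrite -[X in (X < _)%N](expn0 p) ltn_exp2l ?prime_gt1 ?fact_gt0.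
    by move: z0; rewrite -absz_gt0 def_z muln_gt0 => /andP[].
  have -> : (sgz z * z')%:~R = z%:~R / p%:R ^+ N`! :> rat; last first.
    by rewrite stab_dilM // stab_dilV // df dh.
  rewrite [in RHS]sz [in RHS]intrM -[(p ^ _)%N%:Z%:~R]pmulrn natrX mulfK //.
  by rewrite expf_neq0 // pnatr_eq0 -lt0n prime_gt0.
(* Since M e >= e, multiplying by h^e, of dilation n^(M e), clears the denominator n^e; both this
   product and h^e have integer dilations. *)
move=> f; have [l [e df]] := in_ZinvP _ _ (dil_Zinv n_gt1 f).
have [h dh] := stab_power (dvdnn n).
rewrite -(mulgK (h ^+ e)%g f); apply: HM.
  apply: (int_in _ _ (l * n%:Z ^+ (N`! * e - e)) (leqnn _)).
  rewrite stab_dilM // stab_dilX dh df rmorphM rmorphXn /= -pmulrn -exprM.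
  rewrite -{1}(subnK (leq_pmull e (fact_gt0 N))) exprD.
  by rewrite [X in _ * X]mulrC mulrA divfK.
apply/HV/(int_in _ _ (n%:Z ^+ (N`! * e)) (leqnn _)).
by rewrite stab_dilX dh rmorphXn /= -pmulrn exprM.
Qed.

(** Lower bound: on the elements of dilation p^M the valuations form M times the identity matrix.
    Upper bound: too many valuation vectors are dependent over Q, and an integer relation yields a
    product all of whose valuations vanish. *)
Lemma stab_rank : has_rank (Stab g) (size (primes n)).
Proof.
split.
  have pn (i : 'I_(size (primes n))) : (nth 0%N (primes n) i %| n)%N.
    by have := mem_nth 0%N (ltn_ord i); rewrite mem_primes => /and3P[].
  pose x i := sval (cid (stab_power (pn i))).
  have dx i : dil (x i) = (nth 0%N (primes n) i)%:R ^+ N`!.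
    exact: svalP (cid (stab_power (pn i))).
  exists x => m /(congr1 (fun f : Stab g => dil f)); rewrite stab_dil_prod stab_dil1 // => prod1 i.
  set p := nth 0%N (primes n) i.
  have p_pr (i' : 'I_(size (primes n))) : prime (nth 0%N (primes n) i').
    by have := mem_nth 0%N (ltn_ord i'); rewrite mem_primes => /andP[].
  move/(congr1 (ratval p)): prod1; rewrite ratval1 ratval_prod; last first.
    by move=> i'; exact: dil_neq0'.
  rewrite (bigD1 i) //= big1 ?addr0 => [|i' ii'].
    rewrite stab_dilXz // ratvalXz ?dil_neq0' // dx exprnP ratvalXz; last first.
      by rewrite pnatr_eq0 -lt0n prime_gt0.
    rewrite ratval_nat logn_prime // eqxx mulr1 => /eqP; rewrite mulf_eq0.
    by case/orP => [/eqP //|]; rewrite eqz_nat -leqn0 leqNgt fact_gt0.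
  rewrite stab_dilXz // ratvalXz ?dil_neq0' // dx exprnP ratvalXz; last first.
    by rewrite pnatr_eq0 -lt0n prime_gt0.
  rewrite ratval_nat logn_prime // /p nth_uniq ?primes_uniq //.
  by rewrite eq_sym (negPf (ii' : val i' != val i)) !mulr0.
move=> s x indep; rewrite leqNgt; apply/negP => r_lt_s.
pose A : 'M[rat]_(s, size (primes n)) :=
  \matrix_(i, l) (ratval (nth 0%N (primes n) l) (dil (x i)))%:~R.
have : kermx A != 0.
  rewrite kermx_eq0 /row_free; apply/negP => /eqP rkA.
  by have := rank_leq_col A; rewrite rkA leqNgt r_lt_s.
case/rowV0Pn => c /sub_kermxP cA /eqP c_neq0; apply: c_neq0.
(* [E] is the product of all denominators of [c] and [D i] omits the i-th, so m i = c_i E is an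
   integer. *)
pose D i := \prod_(i' | i' != i) denq (c 0 i').
pose m i : int := numq (c 0 i) * D i.
pose E : int := \prod_i denq (c 0 i).
have E_neq0 : E != 0 by apply/prodf_neq0 => i _; exact: denq_neq0.
have mE i : (m i)%:~R = c 0 i * E%:~R :> rat.
  by rewrite /m /E (bigD1 i) //= !rmorphM /= numqE mulrA.
pose f := (\prod_i expgz (x i) (m i))%g.
have df : dil f = \prod_i dil (x i) ^ m i.
  by rewrite stab_dil_prod //; apply: eq_bigr => i _; exact: stab_dilXz.
have f2 : dil f ^+ 2 = 1.
  apply: (@ratval_unit_sqr n n_gt1) => //; first exact: dil_Zinv.
    by rewrite -stab_dilV //; exact: dil_Zinv.
  move=> p /(nthP 0%N)[l l_lt <-]; rewrite df ratval_prod; last first.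
    by move=> i; rewrite expfz_neq0 // dil_neq0'.
  apply: (@intr_inj rat); rewrite rmorph0 rmorph_sum /=.
  have /matrixP/(_ 0 (Ordinal l_lt)) := cA; rewrite !mxE => /(congr1 ( *%R E%:~R)).
  rewrite mulr0 mulr_sumr => eq0; rewrite -[RHS]eq0; apply: eq_bigr => i _.
  by rewrite ratvalXz ?dil_neq0' // rmorphM /= mE !mxE mulrA [E%:~R * _]mulrC.
have m0 i : m i = 0.
  (* The product has dilation 1 or -1, so only the doubled exponents give a relation. *)
  suff : m i * 2 = 0 by lia.
  apply: (indep (fun i => m i * 2)); apply: stab_eqP => //.
  rewrite stab_dil1 // -f2 df stab_dil_prod // -prodrXl; apply: eq_bigr => i' _.
  by rewrite stab_dilXz // -exprz_exp.
apply/rowP => i; rewrite mxE; apply/eqP.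
have := mE i; rewrite m0 => /esym/eqP; rewrite mulf_eq0 intr_eq0 (negPf E_neq0) orbF.
by [].
Qed.

End StabUnits.

(** * The algorithm *)

Section Algorithm.

Definition tails (i c : nat) : nat := iter i code_behead c.

(* The height of the length-i prefix of the word coded by c, shifted by c so
   that truncated subtraction never truncates. *)
Definition prefix_height (i c : nat) : nat :=
  prim_rec c (fun j z => z + (logn 2 (tails j c) == 2) - (logn 2 (tails j c) == 3)) i.

(** A letter a or a^-1 read at height h adds n^h or -n^h to the translation. A code is odd exactly
    when the word starts with a; testing whether [logn 2] is 0 would also accept the empty word.
    Terms past the end of the word vanish. *)
Definition pos_part (n c : nat) : nat :=
  \sum_(i < c) (tails i c %% 2) * n ^ prefix_height i c.
Definition neg_part (n c : nat) : nat :=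
  \sum_(i < c) (logn 2 (tails i c) == 1) * n ^ prefix_height i c.
Definition end_height (c : nat) : nat := prefix_height c c.

(** For k < 0, [k] = - n^k N, so x/[k] has the opposite numerator over N n^(c+k): the two parts
    swap, and [low_height] becomes c + k. *)
Definition num_pos (n c : nat) : nat :=
  if end_height c < c then neg_part n c else pos_part n c.
Definition num_neg (n c : nat) : nat :=
  if end_height c < c then pos_part n c else neg_part n c.
Definition low_height (c : nat) : nat :=
  if end_height c < c then end_height c else c.
(** One of the two truncated differences is 0, so there are |k| terms. *)
Definition modulus (n c : nat) : nat :=
  \sum_(i < (end_height c - c) + (c - end_height c)) n ^ i.
Definition unit_bound (n c : nat) : nat := n ^ (modulus n c)`!.

(* The index e stands for the integer u = unit_pos e - unit_neg e, which is
   e./2 or - e./2 according to the parity of e. *)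
Definition unit_pos (e : nat) : nat := e %% 2 * (e %/ 2).
Definition unit_neg (e : nat) : nat := (1 - e %% 2) * (e %/ 2).

(* With y = num_pos - num_neg, (1 - u) y = cofactor_pos - cofactor_neg. *)
Definition cofactor_pos (n c e : nat) : nat :=
  (unit_neg e).+1 * num_pos n c + unit_pos e * num_neg n c.
Definition cofactor_neg (n c e : nat) : nat :=
  (unit_neg e).+1 * num_neg n c + unit_pos e * num_pos n c.

Definition admissible (n c e : nat) : bool :=
  (unit_pos e + unit_neg e %| unit_bound n c) &&
  (cofactor_pos n c e %% modulus n c == cofactor_neg n c e %% modulus n c).

Definition image_a (e : nat) : bs_word :=
  nseq (unit_pos e) (GenA, false) ++ nseq (unit_neg e) (GenA, true).
(** For an admissible index both cofactors have the same remainder mod N, so the rounded quotients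
    differ by exactly (1 - u) y / N. The exponents of t differ by the required height 1. *)
Definition image_t (n c e : nat) : bs_word :=
  nf_word (low_height c) (cofactor_pos n c e %/ modulus n c)
    (cofactor_neg n c e %/ modulus n c) (low_height c).+1.

(** The range reaches both indices 2 |u| and 2 |u| + 1 for every |u| up to the bound. *)
Definition generator_words (n c : nat) : seq (bs_word * bs_word) :=
  [seq (image_a e, image_t n c e) |
     e <- rev (iota 0 (2 * unit_bound n c + 2)) & admissible n c e].

(** * Recursiveness of the algorithm *)

Lemma recursive_tails : recursive2 tails.
Proof.
apply: (@recursive_ext _ (fun v =>
    prim_rec (nth 0 v 1) (fun i z => code_behead z) (nth 0 v 0))).
  by move=> v _; elim: (nth 0 v 0) => [|i /= ->].
apply: recursive_prim; try exact: recursive_proj.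
by apply: (recursive_app1 recursive_code_behead); exact: recursive_proj.
Qed.

(* Syntactic dispatch on the head symbol: plain unification would match
   x.+1 * y with addn by unfolding. *)
Ltac recursive_tac := repeat lazymatch goal with
  | |- recursive _ (fun=> ?c) => exact: recursive_const
  | |- recursive _ (fun v => nth 0 v _) => exact: recursive_proj
  | |- recursive _ (fun v => nth 0 (drop _ v) _) => exact: recursive_proj_drop
  | |- recursive _ (fun v => (@?F v).+1) => apply: recursive_succ
  | |- recursive _ (fun v => @?F v + @?G v) =>
      apply: (recursive_app2 recursive_addn)
  | |- recursive _ (fun v => @?F v - @?G v) =>
      apply: (recursive_app2 recursive_subn)
  | |- recursive _ (fun v => @?F v * @?G v) =>
      apply: (recursive_app2 recursive_muln)
  | |- recursive _ (fun v => @?F v ^ @?G v) =>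
      apply: (recursive_app2 recursive_expn)
  | |- recursive _ (fun v => @?F v %/ @?G v) =>
      apply: (recursive_app2 recursive_divn)
  | |- recursive _ (fun v => @?F v %% @?G v) =>
      apply: (recursive_app2 recursive_modn)
  | |- recursive _ (fun v => factorial (@?F v)) =>
      apply: (recursive_app1 recursive_fact)
  | |- recursive _ (fun v => logn 2 (@?F v)) =>
      apply: (recursive_app1 recursive_logn2)
  | |- recursive _ (fun v => tails (@?F v) (@?G v)) =>
      apply: (recursive_app2 recursive_tails)
  | |- recursive _ (fun v => nat_of_bool (@?F v && @?G v)) =>
      apply: recursive_and
  | |- recursive _ (fun v => nat_of_bool (@?F v %| @?G v)) =>
      apply: (recursive_app2 recursive_dvdn)
  | |- recursive _ (fun v => nat_of_bool (@?F v <= @?G v)) =>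
      apply: (recursive_app2 recursive_leq)
  | |- recursive _ (fun v => nat_of_bool (@?F v == @?G v)) =>
      apply: (recursive_app2 recursive_eq)
  end.

Lemma recursive_prefix_height : recursive2 prefix_height.
Proof.
apply: (recursive_prim (h := fun j z v => z + (logn 2 (tails j (nth 0 v 1)) == 2)
  - (logn 2 (tails j (nth 0 v 1)) == 3))); recursive_tac.
Qed.

Lemma recursive_pos_part : recursive2 pos_part.
Proof.
apply: (recursive_sum (F := fun i v => (tails i (nth 0 v 1) %% 2)
  * nth 0 v 0 ^ prefix_height i (nth 0 v 1))); recursive_tac.
apply: (recursive_app2 recursive_prefix_height); recursive_tac.
Qed.

Lemma recursive_neg_part : recursive2 neg_part.
Proof.
apply: (recursive_sum (F := fun i v => (logn 2 (tails i (nth 0 v 1)) == 1)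
  * nth 0 v 0 ^ prefix_height i (nth 0 v 1))); recursive_tac.
apply: (recursive_app2 recursive_prefix_height); recursive_tac.
Qed.

Lemma recursive_end_height : recursive1 end_height.
Proof. apply: (recursive_app2 recursive_prefix_height); recursive_tac. Qed.

Lemma recursive_num_pos : recursive2 num_pos.
Proof.
apply: recursive_if.
- by recursive_tac; apply: (recursive_app1 recursive_end_height); recursive_tac.
- by apply: (recursive_app2 recursive_neg_part); recursive_tac.
- by apply: (recursive_app2 recursive_pos_part); recursive_tac.
Qed.

Lemma recursive_num_neg : recursive2 num_neg.
Proof.
apply: recursive_if.
- by recursive_tac; apply: (recursive_app1 recursive_end_height); recursive_tac.
- by apply: (recursive_app2 recursive_pos_part); recursive_tac.
- by apply: (recursive_app2 recursive_neg_part); recursive_tac.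
Qed.

Lemma recursive_low_height : recursive1 low_height.
Proof.
apply: recursive_if; recursive_tac;
  by apply: (recursive_app1 recursive_end_height); recursive_tac.
Qed.

Lemma recursive_modulus : recursive2 modulus.
Proof.
apply: (recursive_sum (F := fun i v => nth 0 v 0 ^ i)); recursive_tac;
  by apply: (recursive_app1 recursive_end_height); recursive_tac.
Qed.

Lemma recursive_unit_bound : recursive2 unit_bound.
Proof.
apply: (recursive_app2 recursive_expn); recursive_tac.
by apply: (recursive_app2 recursive_modulus); recursive_tac.
Qed.

Lemma recursive_unit_pos : recursive1 unit_pos.
Proof. rewrite /recursive1 /unit_pos; recursive_tac. Qed.

Lemma recursive_unit_neg : recursive1 unit_neg.
Proof. rewrite /recursive1 /unit_neg; recursive_tac. Qed.

Lemma recursive_cofactor_pos : recursive3 cofactor_pos.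
Proof.
rewrite /recursive3 /cofactor_pos; recursive_tac.
- by apply: (recursive_app1 recursive_unit_neg); recursive_tac.
- by apply: (recursive_app2 recursive_num_pos); recursive_tac.
- by apply: (recursive_app1 recursive_unit_pos); recursive_tac.
- by apply: (recursive_app2 recursive_num_neg); recursive_tac.
Qed.

Lemma recursive_cofactor_neg : recursive3 cofactor_neg.
Proof.
rewrite /recursive3 /cofactor_neg; recursive_tac.
- by apply: (recursive_app1 recursive_unit_neg); recursive_tac.
- by apply: (recursive_app2 recursive_num_neg); recursive_tac.
- by apply: (recursive_app1 recursive_unit_pos); recursive_tac.
- by apply: (recursive_app2 recursive_num_pos); recursive_tac.
Qed.

Lemma recursive_admissible : recursive3 admissible.
Proof.
rewrite /recursive3 /admissible; recursive_tac.
- by apply: (recursive_app1 recursive_unit_pos); recursive_tac.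
- by apply: (recursive_app1 recursive_unit_neg); recursive_tac.
- by apply: (recursive_app2 recursive_unit_bound); recursive_tac.
- by apply: (recursive_app3 recursive_cofactor_pos); recursive_tac.
- by apply: (recursive_app2 recursive_modulus); recursive_tac.
- by apply: (recursive_app3 recursive_cofactor_neg); recursive_tac.
- by apply: (recursive_app2 recursive_modulus); recursive_tac.
Qed.

Lemma recursive_image_a : recursive1 (fun e => code_word (image_a e)).
Proof.
apply: (recursive_word_nseq (W := fun v => nseq (unit_neg (nth 0 v 0)) (GenA, true))).
  exact: recursive_unit_pos.
apply: (@recursive_ext _ (fun v =>
  code_word (nseq (unit_neg (nth 0 v 0)) (GenA, true) ++ [::]))).
  by move=> v _; rewrite cats0.
by apply: (recursive_word_nseq (W := fun=> [::])); [exact: recursive_unit_neg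
  | exact: recursive_const].
Qed.

Lemma recursive_image_t : recursive3 (fun n c e => code_word (image_t n c e)).
Proof.
have lowR : recursive 3 (fun v => low_height (nth 0 v 1)).
  by apply: (recursive_app1 recursive_low_height); recursive_tac.
have modR : recursive 3 (fun v => modulus (nth 0 v 0) (nth 0 v 1)).
  by apply: (recursive_app2 recursive_modulus); recursive_tac.
suff : recursive_word 3 (fun v =>
  (nseq (low_height (nth 0 v 1)) (GenT, true) ++
  nseq (cofactor_pos (nth 0 v 0) (nth 0 v 1) (nth 0 v 2)
          %/ modulus (nth 0 v 0) (nth 0 v 1)) (GenA, false) ++
  nseq (cofactor_neg (nth 0 v 0) (nth 0 v 1) (nth 0 v 2)
          %/ modulus (nth 0 v 0) (nth 0 v 1)) (GenA, true) ++
  nseq (low_height (nth 0 v 1)).+1 (GenT, false) ++ [::])).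
  by apply: recursive_ext => v _; rewrite cats0.
apply: recursive_word_nseq => //; apply: recursive_word_nseq.
  by apply: (recursive_app2 recursive_divn) => //; exact: recursive_cofactor_pos.
apply: recursive_word_nseq.
  by apply: (recursive_app2 recursive_divn) => //; exact: recursive_cofactor_neg.
by apply: recursive_word_nseq; [exact: recursive_succ | exact: recursive_const].
Qed.

Lemma recursive_generator_words :
  recursive2 (fun n c => code_pairs (generator_words n c)).
Proof.
apply: (@recursive_ext _ (fun v => CodeSeq.code
   [seq code_cons (code_word (image_a e))
          (code_cons (code_word (image_t (nth 0 v 0) (nth 0 v 1) e)) 0)
   | e <- rev (iota 0 (2 * unit_bound (nth 0 v 0) (nth 0 v 1) + 2))
   & admissible (nth 0 v 0) (nth 0 v 1) e])).
  move=> v _; rewrite /code_pairs /generator_words -map_comp; congr CodeSeq.code.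
  by apply: eq_map => e /=; rewrite /code_pair !code_consE.
apply: (recursive_code_filter
  (F := fun e v => code_cons (code_word (image_a e))
          (code_cons (code_word (image_t (nth 0 v 0) (nth 0 v 1) e)) 0))
  (T := fun e v => admissible (nth 0 v 0) (nth 0 v 1) e)).
- recursive_tac; exact: recursive_unit_bound.
- by apply: (recursive_app3 recursive_admissible); recursive_tac.
apply: (recursive_app2 recursive_code_cons).
  by apply: (recursive_app1 recursive_image_a); recursive_tac.
apply: (recursive_app2 recursive_code_cons); last exact: recursive_const.
by apply: (recursive_app3 recursive_image_t); recursive_tac.
Qed.

End Algorithm.

(** * Reading the affine map off the code of a word *)

Section Correctness.
Local Open Scope ring_scope.
Variable n : nat.
Hypothesis n_gt1 : (1 < n)%N.

Lemma code_word_cons l w :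
  code_word (l :: w) = code_cons (code_letter l) (code_word w).
Proof. exact: code_consE. Qed.

Lemma size_code_word w : (size w <= code_word w)%N.
Proof.
elim: w => [|l w IHw] //; rewrite code_word_cons /code_cons.
have : (0 < 2 ^ code_letter l)%N by rewrite expn_gt0.
by rewrite /=; nia.
Qed.

Lemma tails_code i w : tails i (code_word w) = code_word (drop i w).
Proof.
elim: i => [|i IHi]; first by rewrite drop0.
rewrite -[tails _ _]/(code_behead (tails i _)) IHi -[i.+1]add1n -drop_drop.
case: (drop i w) => [|l w'] /=; last by rewrite code_word_cons code_consK drop0.
by rewrite /code_behead div0n.
Qed.

Lemma aff_word_rcons w l :
  aff_word n (rcons w l) = aff_mul n (aff_word n w) (aff_letter l).
Proof.
rewrite -cats1 aff_word_cat //; congr aff_mul.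
by rewrite /aff_word /aff_mul /=; case: (aff_letter l) => x k; rewrite mulr0 !addr0.
Qed.

Lemma prefix_heightS i c : prefix_height i.+1 c =
  (prefix_height i c + (logn 2 (tails i c) == 2) - (logn 2 (tails i c) == 3))%N.
Proof. by []. Qed.

(** The first conjunct is the invariant behind the shift: heights start at c and drop by at most 1
    per letter, so no subtraction truncates. *)
Lemma aff_word_prefix w i (c := code_word w) : (i <= c)%N ->
  (c <= prefix_height i c + i)%N /\
  aff_word n (take i w) =
  (((\sum_(j < i) (tails j c %% 2) * n ^ prefix_height j c)%N%:R
    - (\sum_(j < i) (logn 2 (tails j c) == 1%N) * n ^ prefix_height j c)%N%:R)
     / n%:R ^+ c,
   (prefix_height i c)%:Z - c%:Z).
Proof.
elim: i => [|i IHi] i_le; first by rewrite take0 !big_ord0 subrr mul0r /= subrr leq_addr.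
have [c_le IH] := IHi (ltnW i_le).
have nX0 : (n%:R : rat) ^+ c != 0 by rewrite expf_neq0 ?natQ_neq0.
have expH : (n%:R : rat) ^ ((prefix_height i c)%:Z - c%:Z)
            = (n ^ prefix_height i c)%N%:R / n%:R ^+ c.
  by rewrite expfzDr ?natQ_neq0 // -exprnN natrX.
rewrite !big_ord_recr /= prefix_heightS !natrD.
set P := (\sum_(_ < i) _)%N in IH *; set Q := (\sum_(_ < i) _)%N in IH *.
have -> : tails i c = code_word (drop i w) := tails_code i w.
case eq_d : (drop i w) => [|l w'].
  (* Past the end of the word the tail has code 0, which changes neither the sums nor the height. *)
  have le_sw : (size w <= i)%N by have := size_drop i w; rewrite eq_d /=; lia.
  rewrite take_oversize // in IH; rewrite take_oversize; last exact: leqW.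
  have -> : code_word [::] = 0%N by [].
  rewrite IH logn0 mod0n !mul0n !addr0 !addn0 subn0; split=> //.
  by lia.
have take_i : take i.+1 w = rcons (take i w) l.
  have i_lt : (i < size w)%N by rewrite -subn_gt0 -size_drop eq_d.
  rewrite (take_nth l i_lt); congr rcons.
  by rewrite -[i]addn0 -nth_drop eq_d.
rewrite take_i aff_word_rcons IH code_word_cons logn2_code_cons.
rewrite /aff_mul /= expH.
have odd_cons h m : (code_cons h m %% 2)%N = (h == 0)%N.
  by rewrite modn2 /code_cons oddM oddX /= oddM /= orbF andbT; case: h.
rewrite odd_cons; case: l {IH eq_d take_i} => [[] []] /=;
  rewrite ?mul1n ?mul0n ?addn0 ?subn0 ?addr0; split; try lia.
- by congr pair; rewrite natrX; move: nX0; move: (n%:R ^+ c) => E E0; field.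
- by congr pair; rewrite natrX; move: nX0; move: (n%:R ^+ c) => E E0; field.
- by congr pair; [rewrite mulr0 addr0 | lia].
- by congr pair; [rewrite mulr0 addr0 | lia].
Qed.

End Correctness.

(** * The listed automorphisms lie in the stabilizer and generate it *)

Section Output.
Local Open Scope ring_scope.
Variables (n : nat) (w : bs_word).
Hypothesis n_gt1 : (1 < n)%N.
Let c := code_word w.
Let g := bs_class n w.
Let N := modulus n c.
Let y : int := (num_pos n c)%:Z - (num_neg n c)%:Z.
Let j := low_height c.
Hypothesis k_neq0 : height g != 0.

Let nX_neq0 e : (n%:R : rat) ^+ e != 0.
Proof. by rewrite expf_neq0 ?natQ_neq0. Qed.

Lemma aff_val_code :
  trans g = ((pos_part n c)%:R - (neg_part n c)%:R) / n%:R ^+ c /\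
  height g = (end_height c)%:Z - c%:Z.
Proof.
have [_] := aff_word_prefix n_gt1 (leqnn (code_word w)).
rewrite take_oversize; last exact: size_code_word.
rewrite -/c => aff_w.
by rewrite /trans /height /g aff_val_class // aff_w.
Qed.

Lemma geometric_sum m :
  (n%:R - 1) * (\sum_(i < m) n ^ i)%N%:R = n%:R ^+ m - 1 :> rat.
Proof.
rewrite subrX1 natr_sum; congr (_ * _).
by apply: eq_bigr => i _; rewrite natrX.
Qed.

(** As k is nonzero the sum has a term of index 0, equal to 1; the others are multiples of n, so N
    is 1 mod n. *)
Lemma modulus_coprime : (0 < N)%N /\ coprime n N.
Proof.
have [_ defk] := aff_val_code; move: k_neq0; rewrite defk /N /modulus.
case def_m: (_ + _)%N => [|m]; first by lia.
rewrite big_ord_recl expn0 => _; split=> //.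
rewrite /bump /=; under eq_bigr do rewrite expnS.
by rewrite -big_distrr /= coprime_sym -coprime_modl mulnC addnC modnMDl coprime_modl coprime1n.
Qed.

(** Supplies the data required by the structure results; both signs of k rest on (n - 1) N = n^|k| -
    1. *)
Lemma stab_parameters :
  trans g / qint n (height g) = y%:~R / (N%:R * n%:R ^+ j).
Proof.
have [-> defk] := aff_val_code; have [N_gt0 _] := modulus_coprime.
have n1 : (n%:R : rat) - 1 != 0 by rewrite subr_eq0 natQ_neq1.
have N0 : (N%:R : rat) != 0 by rewrite pnatr_eq0 -lt0n.
have := geometric_sum (end_height c - c + (c - end_height c)).
rewrite -/(modulus n c) -/N => geoN.
rewrite /qint defk /y /j /num_pos /num_neg /low_height rmorphB /= -!pmulrn.
case: (ltnP (end_height c) c) => K_c.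
  move: geoN; have -> : (end_height c - c + (c - end_height c) = c - end_height c)%N by lia.
  have -> : (n%:R : rat) ^+ c = n%:R ^+ (c - end_height c) * n%:R ^+ end_height c.
    by rewrite -exprD subnK // ltnW.
  have -> : (end_height c)%:Z - c%:Z = - (c - end_height c)%N%:Z by lia.
  rewrite -exprnN; move: (nX_neq0 (c - end_height c)) (nX_neq0 (end_height c)).
  move: (n%:R ^+ (c - _)) (n%:R ^+ end_height c) => A B A0 B0 geoN.
  have -> : A^-1 - 1 = - ((n%:R - 1) * N%:R) / A by rewrite geoN; field.
  by field; rewrite N0 A0 B0 n1.
move: geoN; have -> : (end_height c - c + (c - end_height c) = end_height c - c)%N by lia.
have -> : (end_height c)%:Z - c%:Z = (end_height c - c)%N%:Z by lia.
rewrite -exprnP => <-; move: (nX_neq0 c); move: (n%:R ^+ c) => A A0.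
by field; rewrite N0 A0 n1.
Qed.

Let unit_int (e : nat) : int := (unit_pos e)%:Z - (unit_neg e)%:Z.

Lemma abs_unit_int e : `|unit_int e|%N = (unit_pos e + unit_neg e)%N.
Proof.
rewrite /unit_int /unit_pos /unit_neg modn2.
by case: (odd e); rewrite ?mul1n ?mul0n ?subn0 ?subnn; lia.
Qed.

Lemma cofactor_diff e :
  (cofactor_pos n c e)%:Z - (cofactor_neg n c e)%:Z = (1 - unit_int e) * y.
Proof. by rewrite /cofactor_pos /cofactor_neg /unit_int /y; lia. Qed.

Lemma admissible_stab e : admissible n c e ->
  exists f : Stab g, dil f = (unit_int e)%:~R /\
    (f (bs_a n) = bs_class n (image_a e) /\
     f (bs_t n) = bs_class n (image_t n c e)).
Proof.
case/andP => u_dvd /eqP eq_mod; have [N_gt0 _] := modulus_coprime.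
have B_gt0 : (0 < unit_bound n c)%N by rewrite expn_gt0 ltnW.
have u0 : unit_int e != 0.
  by rewrite -absz_gt0 abs_unit_int; apply: dvdn_gt0 u_dvd.
(* The translation of the word [image_t]; the equal remainders cancel in [v_eq]. *)
pose v : rat := ((cofactor_pos n c e %/ N)%N%:R - (cofactor_neg n c e %/ N)%N%:R)
  / n%:R ^+ j.
have v_eq : v = (1 - (unit_int e)%:~R) * y%:~R / (N%:R * n%:R ^+ j).
  have N0 : (N%:R : rat) != 0 by rewrite pnatr_eq0 -lt0n.
  have -> : (1 - (unit_int e)%:~R) * y%:~R
     = (cofactor_pos n c e)%:R - (cofactor_neg n c e)%:R :> rat.
    by rewrite -[1]/(1%:~R) -intrB -intrM -cofactor_diff intrB.
  rewrite {1}(divn_eq (cofactor_pos n c e) N) {1}(divn_eq (cofactor_neg n c e) N).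
  rewrite /N eq_mod -/N !natrD !natrM /v.
  move: (nX_neq0 j); move: (n%:R ^+ j) => A A0; field.
  by rewrite N0 A0.
have uQ0 : (unit_int e)%:~R != 0 :> rat by rewrite intr_eq0.
have [|||f df sf] := stab_exists (g := g) (v := v) n_gt1 (Zinv_int n (unit_int e)) _ uQ0.
- case/dvdnP: u_dvd => q def_B; apply/in_ZinvP.
  (* From n^M = q |u| follows u^-1 = sgn(u) q / n^M. *)
  exists (sgz (unit_int e) * q%:Z), ((modulus n c)`!).
  have -> : (n%:R : rat) ^+ (modulus n c)`! = q%:R * `|unit_int e|%N%:R.
    by rewrite -natrX -/(unit_bound n c) def_B natrM abs_unit_int.
  have -> : (unit_int e)%:~R = (sgz (unit_int e))%:~R * `|unit_int e|%N%:R :> rat.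
    by rewrite {1}[unit_int e]intEsg rmorphM /= pmulrn.
  have q0 : (q%:R : rat) != 0.
    rewrite pnatr_eq0; apply: contraTneq B_gt0 => q0.
    by rewrite def_B q0.
  have m0 : (`|unit_int e|%N%:R : rat) != 0 by rewrite pnatr_eq0 absz_eq0.
  rewrite rmorphM /= -pmulrn; case: sgzP u0 => // _ _.
    by rewrite !mul1r; field; rewrite q0 m0.
  by rewrite rmorphN1; field; rewrite q0 m0.
- apply/in_ZinvP; exists ((cofactor_pos n c e %/ N)%N%:Z - (cofactor_neg n c e %/ N)%N%:Z), j.
  by rewrite rmorphB /= -!pmulrn.
- rewrite v_eq -[X in qint n _ * X]mulrA -stab_parameters.
  have qk : qint n (height g) != 0.
    by apply: contraNneq k_neq0 => /(qint_eq0 n_gt1) ->.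
  by move: (qint _ _) qk => q q0; field.
exists f; split=> //; split; apply: bs_eqP => //.
- rewrite -/(dil f) df /trans aff_val_class //.
  have -> : image_a e = nf_word 0 (unit_pos e) (unit_neg e) 0.
    by rewrite /nf_word /image_a cats0.
  by rewrite aff_word_nf //= divr1 rmorphB.
- rewrite aut_height // height_a // /height aff_val_class //.
  have -> : image_a e = nf_word 0 (unit_pos e) (unit_neg e) 0.
    by rewrite /nf_word /image_a cats0.
  by rewrite aff_word_nf.
- by rewrite -/(shift f) sf /trans aff_val_class // aff_word_nf.
- rewrite aut_height // height_t // /height aff_val_class // aff_word_nf //=.
  by lia.
Qed.

Lemma stab_admissible (f : Stab g) (z : int) :
  dil f = z%:~R -> (`|z| %| n ^ N`!)%N ->
  exists2 e, (e \in rev (iota 0 (2 * unit_bound n c + 2))) && admissible n c e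
    & unit_int e = z.
Proof.
move=> df z_dvd; have [N_gt0 N_coprime] := modulus_coprime.
have z_le : (`|z| <= unit_bound n c)%N.
  by apply: dvdn_leq => //; rewrite expn_gt0 ltnW.
(* Inverts the indexing: odd indices carry z >= 0, even ones z < 0. *)
pose e := (2 * `|z| + (0 <= z)%R)%N.
have e2 : (e %/ 2 = `|z|)%N by rewrite /e; lia.
have em : (e %% 2 = (0 <= z)%R)%N by rewrite /e; lia.
have ez : unit_int e = z.
  by rewrite /unit_int /unit_pos /unit_neg e2 em; lia.
exists e => //; rewrite mem_rev mem_iota add0n /=; apply/andP; split.
  by rewrite /e; lia.
rewrite /admissible -abs_unit_int ez z_dvd /= -/N.
have := stab_dil_int n_gt1 k_neq0 N_gt0 N_coprime stab_parameters df.
by rewrite -ez -cofactor_diff -eqz_mod_dvd !modz_nat eqz_nat.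
Qed.

Lemma generator_words_correct :
  exists2 s : seq (Stab g), specifies (generator_words n c) s & generates s.
Proof.
have [N_gt0 N_coprime] := modulus_coprime.
have spec_exists (es : seq nat) : all (admissible n c) es ->
    exists2 s : seq (Stab g),
      specifies [seq (image_a e, image_t n c e) | e <- es] s &
      forall e, e \in es -> exists2 f, f \in s & dil f = (unit_int e)%:~R.
  elim: es => [|e es IHes] /=; first by exists [::].
  case/andP => /admissible_stab[f [df [fa ft]]] /IHes[s specs dils].
  exists (f :: s); first by rewrite /specifies /= fa ft; congr cons; exact: specs.
  move=> e'; rewrite inE => /predU1P[->|/dils[h hs dh]].
    by exists f; rewrite ?mem_head.
  by exists h; rewrite // inE hs orbT.
have [|s spec_s dil_s] := spec_exists
    [seq e <- rev (iota 0 (2 * unit_bound n c + 2)) | admissible n c e].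
  exact: filter_all.
exists s; first exact: spec_s.
apply: (stab_generates n_gt1 k_neq0 N_gt0 N_coprime stab_parameters) => f z df z_dvd.
have [e /andP[e_in e_adm] ez] := stab_admissible df z_dvd.
have [|h hs dh] := dil_s e; first by rewrite mem_filter e_adm.
(* [dil] is injective on the stabilizer, so the listed element is [f] itself. *)
by rewrite (_ : f = h) //; apply: stab_eqP => //; rewrite dh ez.
Qed.

End Output.

Theorem theorem1p2 :
  exists p : recfun, forall (n : nat) (g : BS n), 2 <= n -> g <> 1%g ->
    isomorphic_additive (Stab g) (Zinv n) \/
    [/\ abelian_group (Stab g),
        finitely_generated (Stab g),
        has_rank (Stab g) (size (primes n)) &
        outputs_generators p g].
Proof.
have [p pP] := recursive_generator_words.
exists p => n g n_gt1 g_neq1.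
have [k0|k_neq0] := eqVneq (height g) 0%R.
  by left; apply: stab_horizontal.
right; have out : outputs_generators p g.
  (* Whatever word is given for g, g may be replaced by its class. *)
  move=> w def_g; case: _ / def_g in k_neq0 *.
  exists (generator_words n (code_word w)); split.
    exact: (pP [:: n; code_word w]).
  exact: generator_words_correct.
split=> //; first exact: stab_abelian.
  have [w def_g] := word_class_surj g.
  by have [ps [_ [s _ gen_s]]] := out w def_g; exists s.
have [w def_g] := word_class_surj g; move: k_neq0; case: _ / def_g => k_neq0.
have [N_gt0 N_coprime] := modulus_coprime n_gt1 k_neq0.
exact: stab_rank N_gt0 N_coprime (stab_parameters n_gt1 k_neq0).
Qed.
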